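(* Let $z>0$, $\beta>0$ and let $H$ be an energy functional of the form $H(\gamma)=\sum_{i=1}^N\Psi(\mathbf x_i)+\sum_{1\le i<j\le N}\Phi(\mathbf x_i,\mathbf x_j)$ for $\gamma=\{\mathbf x_1,\dots,\mathbf x_N\}\in\mathcal M_f$, where $\Psi:\mathcal E\to\mathbb R\cup\{+\infty\}$ and the symmetric function $\Phi:\mathcal E\times\mathcal E\to\mathbb R\cup\{+\infty\}$ are measurable. Write $\mathbf x_i=(x_i,m_i)$. Assume: (1) there exists $A_\Psi>0$ such that $\inf_{x\in\mathbb R^d}\Psi(x,m)\ge -A_\Psi\|m\|^{d+\delta}$ for all $m\in\mathcal S$; (2) there exists $B_\Phi\ge 0$ such that for any $\{\mathbf x_1,\dots,\mathbf x_N\}\in\mathcal M_f$, $\sum_{1\le i<j\le N}\Phi(\mathbf x_i,\mathbf x_j)\ge -B_\Phi\sum_{i=1}^N(1+\|m_i\|^{d+\delta})$; (3) there exists $a_0\ge 0$ such that $\Phi(\mathbf x_i,\mathbf x_j)=0$ whenever $|x_i-x_j|>a_0+\|m_i\|+\|m_j\|$; (4) there exists $\bar B_\Phi\ge 0$ such that for any $\mathbf x=(x,m)\in\mathcal E$ and any tempered configuration $\xi\in\mathcal M^{\mathrm{temp}}$, $\sum_{\mathbf y\in\xi}\Phi(\mathbf x,\mathbf y)\ge -\bar B_\Phi(1+\|m\|^{d+\delta})$. Then for any $N\ge1$, the $N$-point correlation function $\rho_N^{(P^{z,\beta})}$ of any tempered Gibbs point process $P^{z,\beta}\in\mathcal G^{\mathrm{temp}}_{z,\beta}(H)$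 satisfies a Ruelle bound: for $\sigma^{\otimes N}$-almost all $(\mathbf x_1,\dots,\mathbf x_N)\in\mathcal E^N$, $$\rho_N^{(P^{z,\beta})}(\mathbf x_1,\dots,\mathbf x_N)\le\prod_{i=1}^N\mathsf c(\mathbf x_i),\qquad\text{where }\mathsf c(x,m)=\exp\big(\beta(B_\Phi+\bar B_\Phi)(1+\|m\|^{d+\delta})\big).$$
   Context: Setting. Fix $d\ge 1$ and $\delta>0$. $(\mathcal S,\|\cdot\|)$ is a normed space (the mark space), $\mathcal E=\mathbb R^d\times\mathcal S$, and $\mathbf R$ is a probability measure on $\mathcal S$ with $\int_{\mathcal S}e^{\|m\|^{d+2\delta}}\mathbf R(dm)<+\infty$. Put $\lambda(dx,dm)=dx\otimes\mathbf R(dm)$ and $\sigma(d\mathbf x)=e^{-\beta\Psi(\mathbf x)}\lambda(d\mathbf x)$ on $\mathcal E$. Configurations. $\mathcal M$ is the space of $\sigma$-finite simple point measures $\gamma=\sum_i\delta_{\mathbf x_i}$ on $\mathcal E$ ($\mathbf x_i\ne\mathbf x_j$ for $i\neq j$), identified with their sets of atoms; $\mathcal M_f$ is the subset of finite ones, and $\underline o$ is the empty configuration. For $\Lambda\subset\mathbb R^d$, $\gamma_\Lambda=\gamma\cap(\Lambda\times\mathcal S)$, and $\mathcal M_\Lambda$ is the set of configurations supported in $\Lambda\times\mathcal S$. For disjoint configurations, $\gamma\xi=\gamma\cup\xi$. $\mathcal B_b(\mathbb R^d)$ is the set of bounded Borel subsets of $\mathbb R^d$; $|\Lambda|$ is the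 volume of $\Lambda$. Poisson process. For $z>0$, $\tilde\pi^z=1+\sum_{N\ge1}\frac{z^N}{N!}\lambda^{\otimes N}$ on $\mathcal M_f$ (the term $1$ is a unit mass at $\underline o$); for $\Lambda\in\mathcal B_b(\mathbb R^d)$, $\tilde\pi^z_\Lambda$ is its restriction to $\mathcal M_\Lambda$ and $\pi^z_\Lambda=e^{-z|\Lambda|}\tilde\pi^z_\Lambda$. Energies. $H(\underline o)=0$. $E_\Phi(\{\mathbf x_1,\dots,\mathbf x_N\})=\sum_{i<j}\Phi(\mathbf x_i,\mathbf x_j)$; $E_\Phi(\mathbf x\,|\,\xi)=\sum_{\mathbf y\in\xi}\Phi(\mathbf x,\mathbf y)$ and $E_\Phi(\gamma\,|\,\xi)=\sum_{\mathbf x\in\gamma}E_\Phi(\mathbf x\,|\,\xi)$ (conditional energy). Convention $e^{-\infty}=0$. Gibbs point processes. A probability measure $P$ on $\mathcal M$ is an infinite-volume Gibbs point process with energy functional $H$, activity $z>0$ and inverse temperature $\beta>0$, written $P\in\mathcal G_{z,\beta}(H)$, if for every $\Lambda\in\mathcal B_b(\mathbb R^d)$: for any $\gamma\in\mathcal M_f$ and $P$-almost all $\xi\in\mathcal M$ the conditional energy $E_\Phi(\gamma_\Lambda\,|\,\xi_{\Lambda^c})$ is well defined, and for any positive, bounded, measurable $F:\mathcal M\to\mathbb R$, $$\int_{\mathcal M}F(\gamma)P(d\gamma)=\int_{\mathcal M}\frac1{Z^{z,\beta}_\Lambda(\xi)}\int_{\mathcal M_\Lambda}F(\gamma_\Lambda\xi_{\Lambda^c})e^{-\beta(H(\gamma_\Lambda)+E_\Phi(\gamma_\Lambda|\xi_{\Lambda^c}))}\pi^z_\Lambda(d\gamma)\,P(d\xi),$$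 where $Z^{z,\beta}_\Lambda(\xi)$ is the normalising constant (partition function) of the inner integral. Temperedness. $\mathcal M^{\mathrm{temp}}=\bigcup_{t\in\mathbb N^*}\mathcal M^t$, where $\mathcal M^t=\{\gamma\in\mathcal M:\ \forall l\in\mathbb N^*,\ \sum_{(x,m)\in\gamma,\,|x|\le l}(1+\|m\|^{d+2\delta})\le t\,l^d\}$ and $\mathbb N^*=\mathbb N\setminus\{0\}$. $\mathcal G^{\mathrm{temp}}_{z,\beta}(H)$ is the set of $P\in\mathcal G_{z,\beta}(H)$ supported on $\mathcal M^{\mathrm{temp}}$. Correlation functions. For $\gamma\in\mathcal M$ the factorial measure of order $N$ is $\gamma^{(N)}(d\mathbf x_1,\dots,d\mathbf x_N)=\gamma(d\mathbf x_1)(\gamma\setminus\{\mathbf x_1\})(d\mathbf x_2)\cdots(\gamma\setminus\{\mathbf x_1,\dots,\mathbf x_{N-1}\})(d\mathbf x_N)$; the $N$-th factorial moment measure of $P$ is $\alpha_N^{(P)}(\cdot)=\mathbb E_P[\gamma^{(N)}(\cdot)]$ on $\mathcal E^N$. For $P\in\mathcal G_{z,\beta}(H)$, the $N$-point correlation function $\rho_N^{(P)}$ is the Radon–Nikodym derivative of $\alpha_N^{(P)}$ with respect to $(z\sigma)^{\otimes N}$; it is known to admit, $\sigma^{\otimes N}$-a.e., the representation $\rho_N^{(P)}(\mathbf x_1,\dots,\mathbf x_N)=e^{-\beta E_\Phi(\{\mathbf x_1,\dots,\mathbf x_N\})}\int_{\mathcal M}e^{-\beta E_\Phi(\{\mathbf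 x_1,\dots,\mathbf x_N\}|\xi)}P(d\xi)$. *)

(* Defs.v *)
From HB Require Import structures.
From mathcomp Require Import all_boot all_order all_algebra finmap.
From mathcomp Require Import all_classical all_reals all_analysis measurable_realfun.
Set Implicit Arguments.
Unset Strict Implicit.
Unset Printing Implicit Defensive.
Import Order.TTheory GRing.Theory Num.Theory.
Import numFieldNormedType.Exports.
Local Open Scope classical_set_scope.
Local Open Scope ring_scope.

Section density.
Local Open Scope ereal_scope.
Context d (T : measurableType d) (R : realType).
Variables (mu : {sigma_finite_measure set T -> \bar R}) (f : T -> \bar R).
Hypotheses (mf : measurable_fun setT f) (f0 : forall x, 0 <= f x)
  (foo : forall x, f x < +oo).

(* The proofs are arguments so that the measure structure can be inferred. *)
Definition mdensity (_ : measurable_fun setT f) (_ : forall x, 0 <= f x)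
  (_ : forall x, f x < +oo) (A : set T) : \bar R := \int[mu]_(x in A) f x.

Local Notation nu := (mdensity mf f0 foo).

Let nu0 : nu set0 = 0.
Proof. by rewrite /mdensity integral_set0. Qed.

Let nu_ge0 A : 0 <= nu A.
Proof. exact: integral_ge0. Qed.

Let nu_sigma_additive : semi_sigma_additive nu.
Proof.
move=> F mF tF mUF; rewrite /mdensity ge0_integral_bigcup//.
  by apply: is_cvg_ereal_nneg_natsum_cond => n _ _; exact: integral_ge0.
exact: measurable_funTS.
Qed.

HB.instance Definition _ := isMeasure.Build _ _ _ nu
  nu0 nu_ge0 nu_sigma_additive.

Let nu_sigma_finite : sigma_finite setT nu.
Proof.
have [G UG mG] := sigma_finiteT mu.
pose L n : set T := [set x | f x <= n%:R%:E].
have mL n : measurable (L n).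
  by rewrite -[L n]setTI; exact: measurable_lee.
pose K n := G (odflt (0, 0)%N (choice.pickle_inv n)).1
  `&` L (odflt (0, 0)%N (choice.pickle_inv n)).2.
exists K.
  apply/esym; rewrite -subTset => x _.
  have : (\bigcup_i G i) x by rewrite -UG.
  move=> [i _ Gx].
  have [j fj] : exists j : nat, f x <= j%:R%:E.
    have fin : f x \is a fin_num by rewrite ge0_fin_numE.
    exists (Num.truncn (fine (f x))).+1.
    rewrite -(fineK fin) lee_fin; apply/ltW; exact: truncnS_gt.
  exists (choice.pickle (i, j)) => //.
  by rewrite /K choice.pickleK_inv /=.
move=> n; rewrite /K; set i := (odflt _ _).1; set j := (odflt _ _).2.
have [mGi Gi] := mG i.
split; first exact: measurableI.
rewrite /mdensity.
apply: (@le_lt_trans _ _ (\int[mu]_(x in G i `&` L j) j%:R%:E)).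
  apply: ge0_le_integral => //.
  - exact: measurableI.
  - exact: measurable_funTS.
  - by move=> x [].
rewrite integral_cst; last exact: measurableI.
apply: lte_mul_pinfty; rewrite ?lee_fin//.
apply: le_lt_trans Gi; apply: le_measure; rewrite ?inE//.
exact: measurableI.
Qed.

HB.instance Definition _ := Measure_isSigmaFinite.Build _ _ _ nu nu_sigma_finite.

End density.

Lemma mscale_sigma_finite d (T : measurableType d) (R : realType)
    (r : {nonneg R}) (mu : {sigma_finite_measure set T -> \bar R}) :
  sigma_finite setT (mscale r mu).
Proof.
have [G UG mG] := sigma_finiteT mu.
exists G => // n; have [mGn Gn] := mG n; split=> //.
by rewrite /mscale lte_mul_pinfty// lee_fin.
Qed.

(* The library only makes [m1 \x m2] canonically sigma-finite when both factors
   are subprobabilities. *)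
Lemma product_measure_sigma_finite d1 d2 (T1 : measurableType d1)
    (T2 : measurableType d2) (R : realType)
    (m1 : {sigma_finite_measure set T1 -> \bar R})
    (m2 : {sigma_finite_measure set T2 -> \bar R}) :
  sigma_finite setT (m1 \x m2)%E.
Proof.
have /sigma_finiteP[F [TF ndF Foo]] := sigma_finiteT m1.
have /sigma_finiteP[G [TG ndG Goo]] := sigma_finiteT m2.
exists (fun n => F n `*` G n).
  rewrite -setXTT TF TG predeqE => -[x y]; split.
    move=> [/= [n _ Fnx] [k _ Gky]]; exists (maxn n k) => //; split.
    - by move: x Fnx; exact/subsetPset/ndF/leq_maxl.
    - by move: y Gky; exact/subsetPset/ndG/leq_maxr.
  by move=> [n _ []/= ? ?]; split; exists n.
move=> k; have [? ?] := Foo k; have [? ?] := Goo k.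
split; first exact: measurableX.
by rewrite product_measure1E// lte_mul_pinfty// ge0_fin_numE.
Qed.

Section tensor_power.
Local Open Scope ereal_scope.
Context d (T : measurableType d) (R : realType).

Definition tuple_cons n (p : T * n.-tuple T) : n.+1.-tuple T :=
  [the n.+1.-tuple T of p.1 :: p.2].

Definition tuple_uncons n (t : n.+1.-tuple T) : T * n.-tuple T :=
  (tnth t ord0, [tuple of behead t]).

Lemma tuple_consK n : cancel (@tuple_cons n) (@tuple_uncons n).
Proof.
by move=> [x t]; rewrite /tuple_uncons/=; congr pair; exact/val_inj.
Qed.

Lemma measurable_tuple_cons n : measurable_fun setT (@tuple_cons n).
Proof. exact: measurable_cons. Qed.

Lemma measurable_tuple_uncons n : measurable_fun setT (@tuple_uncons n).
Proof.
apply/measurable_fun_pairP; split; first exact: measurable_tnth.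
exact: measurable_behead.
Qed.

HB.instance Definition _ n :=
  isMeasurableFun.Build _ _ _ _ (@tuple_cons n) (@measurable_tuple_cons n).

Section step.
Variables (n : nat) (mu : {sigma_finite_measure set T -> \bar R})
  (nu : {sigma_finite_measure set (n.-tuple T) -> \bar R}).

Definition tensor_step : set (n.+1.-tuple T) -> \bar R :=
  pushforward (mu \x nu) (@tuple_cons n).

Let tensor0 : tensor_step set0 = 0.
Proof. exact: measure0. Qed.

Let tensor_ge0 A : 0 <= tensor_step A.
Proof. exact: measure_ge0. Qed.

Let tensor_sigma_additive : semi_sigma_additive tensor_step.
Proof. exact: measure_semi_sigma_additive. Qed.

HB.instance Definition _ := isMeasure.Build _ _ _ tensor_step
  tensor0 tensor_ge0 tensor_sigma_additive.

Let tensor_sigma_finite : sigma_finite setT tensor_step.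
Proof.
have [G UG mG] := product_measure_sigma_finite mu nu.
exists (fun k => @tuple_uncons n @^-1` G k).
  by rewrite -preimage_bigcup -UG preimage_setT.
move=> k; have [mGk Gk] := mG k; split.
  by rewrite -[X in measurable X]setTI; exact: measurable_tuple_uncons.
rewrite /tensor_step /pushforward -comp_preimage.
by rewrite (_ : _ \o _ = id) ?preimage_id//; apply/funext/tuple_consK.
Qed.

HB.instance Definition _ := Measure_isSigmaFinite.Build _ _ _ tensor_step
  tensor_sigma_finite.

End step.

Variable mu : {sigma_finite_measure set T -> \bar R}.

Fixpoint tensor n : {sigma_finite_measure set (n.-tuple T) -> \bar R} :=
  match n with
  | 0 => dirac [tuple]
  | n'.+1 => tensor_step mu (tensor n')
  end.

End tensor_power.

Definition config_display : measure_display -> measure_display.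
Proof. exact. Qed.

Lemma setU_countable T (A B : set T) :
  countable A -> countable B -> countable (A `|` B).
Proof.
move=> cA cB; rewrite -bigcup2E; apply: bigcup_countable => // -[|[|n]] _ //=.
Qed.

Section configurations.
Context d (T : measurableType d).

(* A sigma-finite simple point measure is identified with its set of atoms,
   which is an arbitrary countable set. *)
Record config := Config {
  atoms :> set T ;
  countable_atoms : countable atoms }.

Lemma config_eq (g h : config) : atoms g = atoms h -> g = h.
Proof.
case: g h => [g cg] [h ch] /= gh; subst h; congr Config.
exact: Prop_irrelevance.
Qed.

HB.instance Definition _ := gen_eqMixin config.
HB.instance Definition _ := gen_choiceMixin config.

Definition empty_config : config := Config (@countable0 T).

HB.instance Definition _ := isPointed.Build config empty_config.

(* The sigma-algebra on configurations is the coarsest one that makes every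
   counting map g |-> #(g `&` B), with B measurable, measurable; these maps take
   values in N U {+oo}, so the events {#(g `&` B) = n} generate it. *)
Definition counting_events : set (set config) :=
  [set A | exists2 B : set T, measurable B &
    exists n : nat, A = [set g : config | (g `&` B #= `I_n)%card]].

HB.instance Definition _ := @isMeasurable.Build (config_display d) config
  <<s counting_events >> (@sigma_algebra0 _ setT counting_events)
  (@sigma_algebraC _ counting_events)
  (@sigma_algebra_bigcup _ setT counting_events).

Definition config_restr (g : config) (B : set T) : config :=
  Config (sub_countable (subset_card_le (@subIsetl _ g B)) (countable_atoms g)).

Definition config_union (g h : config) : config :=
  Config (setU_countable (countable_atoms g) (countable_atoms h)).

Definition configs_in (B : set T) : set config := [set g | g `<=` B].

Definition config_of_seq (s : seq T) : config :=
  Config (finite_set_countable (finite_seq s)).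

End configurations.

Section marked_space.
Context (R : realType).

Definition Rd (n : nat) : measurableType _ := n.-tuple (measurableTypeR R).

Definition euclidean_dist n (x y : Rd n) : R :=
  Num.sqrt (\sum_(i < n) (tnth x i - tnth y i : R) ^+ 2).

Definition euclidean_norm n (x : Rd n) : R :=
  Num.sqrt (\sum_(i < n) (tnth x i : R) ^+ 2).

Definition lebesgue_Rd n : {sigma_finite_measure set (Rd n) -> \bar R} :=
  tensor (@lebesgue_measure R) n.

Definition marks (S : normedModType R) : measurableType _ :=
  g_sigma_algebraType (@open S).

Definition mark_norm (S : normedModType R) (m : marks S) : R := `|(m : S)|.

Definition marked_space (n : nat) (S : normedModType R) : measurableType _ :=
  (Rd n * marks S)%type.

Section lambda_measure.
Context (n : nat) (S : normedModType R) (Q : probability (marks S) R).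

Definition lambda_measure : set (marked_space n S) -> \bar R :=
  (lebesgue_Rd n \x Q)%E.

HB.instance Definition _ := Measure.on lambda_measure.
HB.instance Definition _ := Measure_isSigmaFinite.Build _ _ _ lambda_measure
  (product_measure_sigma_finite (lebesgue_Rd n) Q).

End lambda_measure.
End marked_space.

(* Measurable functions with values in R U {+oo}. *)
Record potential d (T : measurableType d) (R : realType) := Potential {
  potential_fun :> T -> \bar R ;
  measurable_potential : measurable_fun setT potential_fun ;
  potential_gtNy : forall x, (-oo < potential_fun x)%E }.

Lemma measurable_expeR (R : realType) : measurable_fun setT (@expeR R).
Proof.
rewrite (_ : @expeR R = fun x => maxe 0 (er_map expR x))%E.
  apply: measurable_maxe => //; apply: (@measurable_er_map _ (measurableTypeR R)); exact: measurable_expR.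
apply/funext => -[r||]/=.
- by rewrite max_r// lee_fin expR_ge0.
- by rewrite max_r.
- by rewrite max_l.
Qed.

Section boltzmann.
Local Open Scope ereal_scope.
Context (R : realType).

(* As expeR (-oo) = 0, the weight vanishes where the energy is +oo. *)
Definition boltzmann (beta : {posnum R}) (e : \bar R) : \bar R :=
  expeR (- (beta%:num%:E * e)).

Context d (T : measurableType d) (beta : {posnum R}) (V : potential T R).

Lemma measurable_boltzmann_potential :
  measurable_fun setT (fun x => boltzmann beta (V x)).
Proof.
apply: (measurableT_comp (@measurable_expeR R)).
apply: measurableT_comp => //; apply: emeasurable_funM => //.
exact: measurable_potential.
Qed.

Lemma boltzmann_potential_ge0 x : 0 <= boltzmann beta (V x).
Proof. exact: expeR_ge0. Qed.

Lemma boltzmann_potential_lty x : boltzmann beta (V x) < +oo.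
Proof.
rewrite /boltzmann ltey expeR_eqy; apply/eqP.
have := potential_gtNy V x; case: (V x) => [r||]//= _.
by rewrite mulry gtr0_sg// mul1e.
Qed.

End boltzmann.

Section sigma_measure.
Context (R : realType) (n : nat) (S : normedModType R).
Context (Q : probability (marks S) R) (beta : {posnum R})
  (Psi : potential (marked_space n S) R).

Definition sigma_measure : {sigma_finite_measure set (marked_space n S) -> \bar R} :=
  mdensity (lambda_measure Q) (measurable_boltzmann_potential beta Psi)
    (boltzmann_potential_ge0 beta Psi) (boltzmann_potential_lty beta Psi).

Definition activity_sigma (z : {posnum R}) : set (marked_space n S) -> \bar R :=
  mscale (NngNum (ltW (gt0 z))) sigma_measure.

HB.instance Definition _ z := Measure.on (activity_sigma z).
HB.instance Definition _ z := Measure_isSigmaFinite.Build _ _ _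
  (activity_sigma z)
  (mscale_sigma_finite (NngNum (ltW (gt0 z))) sigma_measure).

End sigma_measure.

Lemma card_seqI (T : choiceType) (s : seq T) (B : set T) m : uniq s ->
  ([set` s] `&` B #= `I_m)%card <-> count (fun x => x \in B) s = m.
Proof.
move=> us; pose X := [fset x in [seq x <- s | x \in B]]%fset.
have -> : [set` s] `&` B = [set` X].
  apply/seteqP; split => x; rewrite /= !inE /= mem_filter.
    by move=> [-> /mem_set ->].
  by move=> /andP[/set_mem].
have <- : #|` X| = count (fun x => x \in B) s.
  by rewrite card_fseq undup_id ?filter_uniq// size_filter.
by split => /card_eq_fsetP.
Qed.

Lemma sum_indic_tuple (T : choiceType) (R : realType) N (t : N.-tuple T)
    (B : set T) :
  \sum_(i < N) \1_B (tnth t i) = (count (fun x => x \in B) t)%:R :> R.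
Proof.
rewrite -(big_tuple _ _ t xpredT (fun x => \1_B x : R)).
rewrite -sum1_count natr_sum [RHS]big_mkcond/=; apply: eq_bigr => x _.
by rewrite indicE; case: (x \in B).
Qed.

Lemma measurable_eq_fun d (T : measurableType d) (R : realType) (f g : T -> R) :
  measurable_fun setT f -> measurable_fun setT g ->
  measurable [set t | f t = g t].
Proof.
move=> mf mg.
rewrite (_ : [set t | _] = setT `&` [set t | (f t)%:E = (g t)%:E]).
  by apply: measurable_eqe => //; exact/measurable_EFinP.
by rewrite setTI; apply/seteqP; split => t /=; [move=> -> | case].
Qed.

Section poisson.
Local Open Scope ereal_scope.
Context (R : realType) (n : nat) (S : normedModType R).
Local Notation E := (marked_space n S).
Context (Q : probability (marks S) R).

(* A tuple with a repeated point does not define a simple point measure. The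
   tuples with two points over the same site of R^n are discarded altogether;
   they form a null set of the N-th power of lambda_measure as soon as n > 0. *)
Definition distinct_sites N : set (N.-tuple E) :=
  [set t | forall i j : 'I_N, i != j -> (tnth t i).1 <> (tnth t j).1].

Lemma measurable_distinct_sites N : measurable (@distinct_sites N).
Proof.
pose D (ij : 'I_N * 'I_N) (k : 'I_n) : set (N.-tuple E) :=
  [set t | (tnth (tnth t ij.1).1 k : R) = tnth (tnth t ij.2).1 k].
have mproj (i : 'I_N) (k : 'I_n) :
    measurable_fun setT ((fun t => tnth (tnth t i).1 k) : N.-tuple E -> R).
  have m1 := measurable_tnth (T := measurableTypeR R) k.
  have m2 : measurable_fun setT (fst : E -> Rd R n) by exact: measurable_fst.
  have m3 := measurable_tnth (T := E) i.
  exact: (measurableT_comp m1 (measurableT_comp m2 m3)).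
have mD ij k : measurable (D ij k).
  exact: (measurable_eq_fun (mproj ij.1 k) (mproj ij.2 k)).
rewrite (_ : @distinct_sites N =
    \bigcap_(ij in [set ij : 'I_N * 'I_N | ij.1 != ij.2])
      ~` \bigcap_(k in [set: 'I_n]) D ij k).
  apply: fin_bigcap_measurable => // ij _; apply: measurableC.
  exact: fin_bigcap_measurable.
apply/seteqP; split => t Dt.
  move=> [i j] /= ij Dij; apply: (Dt i j ij); apply: eq_from_tnth => k.
  exact: Dij.
move=> i j ij tij; apply: (Dt (i, j) ij) => k _.
by rewrite /D /= tij.
Qed.

Definition config_of_tuple N (t : N.-tuple E) : config E :=
  if `[< distinct_sites t >] then config_of_seq t else empty_config E.

Lemma measurable_config_of_tuple N : measurable_fun setT (@config_of_tuple N).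
Proof.
apply: (measurability (@counting_events _ E)) => // _ [_ [B mB [m ->]] <-].
rewrite setTI.
pose C : set (N.-tuple E) :=
  [set t | (\sum_(i < N) \1_B (tnth t i) : R)%R = m%:R%R].
have mC : measurable C.
  apply: measurable_eq_fun => //; apply: measurable_sum => i.
  apply: measurableT_comp; first exact: measurable_indic.
  exact: (measurable_tnth (T := E)).
pose D0 : set (N.-tuple E) := [set _ | 0%N = m].
have mD0 : measurable D0.
  by have [m0|m0] := pselect (0%N = m);
    [rewrite (_ : D0 = setT)|rewrite (_ : D0 = set0)] => //;
    apply/seteqP; split.
have mD := @measurable_distinct_sites N.
rewrite [X in measurable X](_ : _ =
  (distinct_sites (N := N) `&` C) `|` (~` distinct_sites (N := N) `&` D0)).
  by apply: measurableU; apply: measurableI => //; exact: measurableC.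
suff CE t : distinct_sites t ->
    (([set` t] `&` B #= `I_m)%card <-> C t).
  apply/seteqP; split => t /=; rewrite /config_of_tuple.
    case: asboolP => /= Dt; first by move=> /(CE _ Dt); left.
    by rewrite -set_nil; move=> /(card_seqI (s := [::]) B m isT); right.
  case => -[Dt]; case: asboolP => //= _; first by move/(CE _ Dt).
  by move=> m0; rewrite -set_nil; apply/(card_seqI (s := [::]) B m isT).
move=> Dt.
have ut : uniq t.
  apply/tuple_uniqP => i j tij; apply/eqP; apply: contraT => ij.
  by case: (Dt i j ij); rewrite tij.
apply: (iff_trans (card_seqI _ _ ut)); rewrite /C /= sum_indic_tuple.
by split => [->//|/eqP]; rewrite eqr_nat => /eqP.
Qed.

HB.instance Definition _ N := isMeasurableFun.Build _ _ _ _
  (@config_of_tuple N) (@measurable_config_of_tuple N).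

Section unordered_tensor.
Variable N : nat.

Definition unordered_tensor : set (config E) -> \bar R :=
  pushforward (mrestr (tensor (lambda_measure Q) N) (@measurable_distinct_sites N))
    (@config_of_tuple N).

Let unordered_tensor0 : unordered_tensor set0 = 0.
Proof. exact: measure0. Qed.

Let unordered_tensor_ge0 A : 0 <= unordered_tensor A.
Proof. exact: measure_ge0. Qed.

Let unordered_tensor_sigma_additive : semi_sigma_additive unordered_tensor.
Proof. exact: measure_semi_sigma_additive. Qed.

HB.instance Definition _ := isMeasure.Build _ _ _ unordered_tensor
  unordered_tensor0 unordered_tensor_ge0 unordered_tensor_sigma_additive.

End unordered_tensor.

Lemma activity_weight_ge0 (z : {posnum R}) N : (0 <= z%:num ^+ N / N`!%:R)%R.
Proof. by rewrite divr_ge0// exprn_ge0. Qed.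

Definition poisson_tilde (z : {posnum R}) : {measure set (config E) -> \bar R} :=
  mseries (fun N => mscale (NngNum (activity_weight_ge0 z N))
    (unordered_tensor N)) 0.

(* This is only rescaled here; the restriction to the configurations in
   L `*` setT is the domain of the integrals in [partition_function] and
   [gibbs]. *)
Definition poisson (z : {posnum R}) (L : set (Rd R n)) :
    {measure set (config E) -> \bar R} :=
  mscale (NngNum (expR_ge0 (- (z%:num * fine (lebesgue_Rd R n L)))))
    (poisson_tilde z).

End poisson.

Section energy.
Local Open Scope ereal_scope.
Context d (T : measurableType d) (R : realType).
Variables (Psi : potential T R) (Phi : potential (T * T)%type R).

(* Meant for finite g and symmetric Phi: the sum runs over i < j for some
   enumeration of g (fset_set g is empty when g is infinite). *)
Definition pair_energy (g : config T) : \bar R :=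
  let s := fset_set g : seq T in
  \sum_(i < size s) \sum_(j < size s | (i < j)%N)
    Phi (nth point s i, nth point s j).

Definition energy (g : config T) : \bar R :=
  \sum_(x \in g) Psi x + pair_energy g.

(* Sum over a countable set of terms of any sign, as the difference of the sums
   of positive and negative parts. Well-definedness, with a value in
   R U {+oo}, means that the sum of the negative parts is finite. *)
Definition point_energy (x : T) (xi : config T) : \bar R :=
  \esum_(y in xi) maxe (Phi (x, y)) 0 - \esum_(y in xi) maxe (- Phi (x, y)) 0.

Definition cond_energy (g xi : config T) : \bar R :=
  \sum_(x \in g) point_energy x xi.

Definition cond_energy_defined (g xi : config T) : Prop :=
  forall x, atoms g x -> \esum_(y in xi) maxe (- Phi (x, y)) 0 < +oo.

End energy.

Section gibbs.
Local Open Scope ereal_scope.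
Context (R : realType) (n : nat) (S : normedModType R).
Local Notation E := (marked_space n S).
Context (Q : probability (marks S) R) (Psi : potential E R)
  (Phi : potential (E * E)%type R).

Definition window (L : set (Rd R n)) : set E := [set x | L x.1].

Definition bounded_borel (L : set (Rd R n)) : Prop :=
  measurable L /\ exists r : R, forall x, L x -> (euclidean_norm x <= r)%R.

Definition gibbs_weight (beta : {posnum R}) (L : set (Rd R n))
    (g xi : config E) : \bar R :=
  boltzmann beta (energy Psi Phi (config_restr g (window L)) +
    cond_energy Phi (config_restr g (window L)) (config_restr xi (window (~` L)))).

Definition partition_function (z beta : {posnum R}) (L : set (Rd R n))
    (xi : config E) : \bar R :=
  \int[poisson Q z L]_(g in configs_in (window L)) gibbs_weight beta L g xi.

Definition gibbs (z beta : {posnum R}) (P : probability (config E) R) : Prop :=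
  forall L : set (Rd R n), bounded_borel L ->
    (forall g : config E, finite_set g ->
      {ae P, forall xi, cond_energy_defined Phi (config_restr g (window L))
        (config_restr xi (window (~` L)))}) /\
    (forall F : config E -> R, measurable_fun setT F ->
      (forall g, 0 <= F g)%R -> (exists C, forall g, F g <= C)%R ->
      \int[P]_g (F g)%:E =
      \int[P]_xi ((partition_function z beta L xi)^-1 *
        \int[poisson Q z L]_(g in configs_in (window L))
          ((F (config_union (config_restr g (window L))
                         (config_restr xi (window (~` L)))))%:E *
           gibbs_weight beta L g xi))).

Definition tempered_at (delta : R) (t : nat) : set (config E) :=
  [set g | forall l : nat, (0 < l)%N ->
    \esum_(x in [set x | atoms g x /\ (euclidean_norm x.1 <= l%:R)%R])
      (1 + mark_norm x.2 `^ (n%:R + 2 * delta))%:E <= (t%:R * l%:R ^+ n)%:E].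

Definition tempered (delta : R) : set (config E) :=
  \bigcup_(t in [set t : nat | (0 < t)%N]) tempered_at delta t.

Definition tempered_gibbs (delta : R) (z beta : {posnum R})
    (P : probability (config E) R) : Prop :=
  gibbs z beta P /\ {ae P, forall g, tempered delta g}.

End gibbs.

Section correlation.
Local Open Scope ereal_scope.
Context d (T : measurableType d) (R : realType).

(* The recursion is g^(N+1)(dx, dt) = g(dx) (g \ {x})^(N)(dt). *)
Fixpoint factorial_measure N : set T -> set (N.-tuple T) -> \bar R :=
  match N with
  | 0 => fun _ => dirac [tuple]
  | N'.+1 => fun g A => \esum_(x in g)
      factorial_measure (g `\ x) [set t | A (tuple_cons (x, t))]
  end.

Definition factorial_moment (P : probability (config T) R) N
    (A : set (N.-tuple T)) : \bar R :=
  \int[P]_g factorial_measure g A.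

(* rho is a version of the Radon-Nikodym derivative of the N-th factorial moment
   measure of P with respect to the N-th power of mu; the library's
   [Radon_Nikodym] only covers finite charges. *)
Definition is_correlation_function (mu : {sigma_finite_measure set T -> \bar R})
    (P : probability (config T) R) N (rho : N.-tuple T -> \bar R) : Prop :=
  [/\ measurable_fun setT rho, forall x, 0 <= rho x &
    forall A, measurable A ->
      factorial_moment P A = \int[tensor mu N]_(x in A) rho x].

End correlation.

(* Main.v *)
Require Import Defs.
From HB Require Import structures.
From mathcomp Require Import all_boot all_order all_algebra finmap.
From mathcomp Require Import all_classical all_reals all_analysis measurable_realfun.

(* Write the DLR equation for a window L and a simple function F below the
   factorial measure g |-> g^(N)(A), where A only involves points over L. The
   inner integral is a sum over M of integrals over M-tuples, in which g^(N)(A)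
   is a sum over the selections of N entries. Removing a selected point x from a
   tuple multiplies the Boltzmann weight by exp(-beta (Psi x + E)), where E is
   the energy of x given the remaining points and the boundary condition; these
   still form a tempered configuration, so E >= -Bbar (1 + |m|^(d+delta)). By
   the invariance of the product measures under moving a coordinate to the front
   (Mecke's formula for the Poisson process), the inner integral is at most the
   partition function times int_A prod_i cbar(x_i) d(z sigma)^N, with
   cbar(x, m) = exp(beta Bbar (1 + |m|^(d+delta))). Hence
   alpha_N(A) <= int_A prod_i cbar d(z sigma)^N, and sigma-finiteness gives
   rho_N <= prod_i cbar almost everywhere.

   The integrals of the DLR equation are suprema over simple functions, so the
   Boltzmann weight must be shown measurable in the configuration before the
   partition function can be bounded below by the sum over M. *)

Set Implicit Arguments.
Unset Strict Implicit.
Unset Printing Implicit Defensive.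
Import Order.TTheory GRing.Theory Num.Theory.
Import numFieldNormedType.Exports.
Import HBNNSimple.
Local Open Scope classical_set_scope.
Local Open Scope ring_scope.
Local Open Scope ereal_scope.

(** * Integrals and tensor powers *)

Section integral_complements.
Context d (T : measurableType d) (R : realType).
Implicit Types f g : T -> \bar R.

(* [ge0_le_integral] without measurability: the integral of a nonnegative
   function is a supremum over the simple functions below it. *)
Lemma le_lower_integral (mu : {measure set T -> \bar R}) f g :
  (forall x, 0 <= f x) -> (forall x, f x <= g x) ->
  \int[mu]_x f x <= \int[mu]_x g x.
Proof.
move=> f0 fg; have g0 x : 0 <= g x by exact: le_trans (fg x).
rewrite !ge0_integralTE//; apply: ge_ereal_sup => _ [h hf <-].
by apply: ereal_sup_ubound; exists h => //= x; exact: le_trans (fg x).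
Qed.

(** An integrand that is not known to be measurable is bounded through the simple functions below
    it, which are. *)
Lemma lower_integral_le (mu : {measure set T -> \bar R}) f (C : \bar R) :
  (forall x, 0 <= f x) ->
  (forall h : {nnsfun T >-> R}, (forall x, (h x)%:E <= f x) ->
    \int[mu]_x (h x)%:E <= C) ->
  \int[mu]_x f x <= C.
Proof.
move=> f0 fC; rewrite ge0_integralTE//; apply: ge_ereal_sup => _ [h hf <-].
by rewrite -integralT_nnsfun; exact: fC.
Qed.


(** The right-hand side of the DLR equation is not known to be measurable in the boundary condition,
    so the almost sure bound is passed to each simple function below it. *)
Lemma ae_le_lower_integral (P : probability T R) f (C : \bar R) :
  (forall x, 0 <= f x) -> 0 <= C -> {ae P, forall x, f x <= C} ->
  \int[P]_x f x <= C.
Proof.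
move=> f0 C0 fC; apply: lower_integral_le => // h hf.
have PC : \int[P]_x (cst C) x = C by rewrite integral_cst//= probability_setT mule1.
rewrite -[leRHS]PC; apply: ae_ge0_le_integral => //.
- by move=> x _; rewrite lee_fin.
- exact/measurable_EFinP.
- by apply: filterS fC => x fx _; exact: le_trans (hf x) fx.
Qed.

Lemma ge0_integral_mrestr (mu : {measure set T -> \bar R}) (D : set T)
    (mD : measurable D) f :
  measurable_fun setT f -> (forall x, 0 <= f x) ->
  \int[mrestr mu mD]_x f x = \int[mu]_(x in D) f x.
Proof.
move=> mf f0.
rewrite (@ge0_negligible_integral _ _ _ _ setT (~` D))//; last 2 first.
- exact: measurableC.
- by change (mu (~` D `&` D) = 0); rewrite setICl measure0.
rewrite setTD setCK; apply: eq_measure_integral => A mA AD.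
by change (mu (A `&` D) = mu A); rewrite setIidl.
Qed.

End integral_complements.

(** Monotone convergence along simple approximations of [h] reduces both sides to simple functions,
    and linearity to indicators, where the identity is the definition of [mdensity]. *)
Lemma ge0_integral_mdensity d (T : measurableType d) (R : realType)
    (mu : {sigma_finite_measure set T -> \bar R}) (f : T -> \bar R)
    (mf : measurable_fun setT f) (f0 : forall x, 0 <= f x)
    (foo : forall x, f x < +oo) (h : T -> \bar R) :
  measurable_fun setT h -> (forall x, 0 <= h x) ->
  \int[mdensity mu mf f0 foo]_x h x = \int[mu]_x (f x * h x).
Proof.
move=> mh h0; pose h_ := nnsfun_approx measurableT mh.
have hE x : h x = limn (fun n => (h_ n x)%:E).
  by apply/esym/cvg_lim => //; exact: cvg_nnsfun_approx.
transitivity (limn (fun n => \int[mdensity mu mf f0 foo]_x (h_ n x)%:E)).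
  rewrite -monotone_convergence//=.
  - by apply: eq_integral => x _.
  - by move=> n; exact/measurable_EFinP.
  - by move=> n x _; rewrite lee_fin.
  - by move=> x _ m n mn; rewrite lee_fin; exact/lefP/nd_nnsfun_approx.
transitivity (limn (fun n => \int[mu]_x (f x * (h_ n x)%:E))); last first.
  rewrite -monotone_convergence//=.
  - apply: eq_integral => x _; rewrite limeMl ?hE//.
      by rewrite ge0_fin_numE.
    by apply/cvg_ex; exists (h x); exact: cvg_nnsfun_approx.
  - by move=> n; apply: emeasurable_funM => //; exact/measurable_EFinP.
  - by move=> n x _; rewrite mule_ge0// lee_fin.
  - move=> x _ m n mn; apply: lee_pmul => //; rewrite lee_fin//.
    exact/lefP/nd_nnsfun_approx.
congr (limn _); apply/funext => n.
under eq_integral do rewrite fimfunE -fsumEFin//.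
rewrite ge0_integral_fsum//; last 2 first.
  - by move=> r; apply/measurable_EFinP; exact: measurableT_comp.
  - by move=> r x _; rewrite EFinM nnfun_muleindic_ge0.
under [RHS]eq_integral.
  move=> x _; rewrite fimfunE -fsumEFin// ge0_mule_fsumr; last first.
    by move=> r; rewrite EFinM nnfun_muleindic_ge0.
  over.
rewrite [RHS]ge0_integral_fsum//; last 2 first.
  - move=> r; apply: emeasurable_funM => //; apply/measurable_EFinP.
    exact: measurableT_comp.
  - by move=> r x _; rewrite mule_ge0// EFinM nnfun_muleindic_ge0.
apply: eq_fsbigr => r _.
(* A nonnegative simple function does not take a negative value: the preimage is empty and both
   sides vanish. *)
have [r0|r0] := leP 0%R r; last first.
  by rewrite !integral0_eq// => x _; rewrite preimage_nnfun0// indic0 mulr0 ?mule0.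
under eq_integral do rewrite EFinM.
rewrite ge0_integralZl//; last by apply/measurable_EFinP.
under [RHS]eq_integral do rewrite EFinM muleCA.
rewrite ge0_integralZl//; last 2 first.
  - by apply: emeasurable_funM => //; exact/measurable_EFinP.
  - by move=> x _; rewrite mule_ge0// lee_fin.
congr (_ * _); rewrite integral_indic// setIT /mdensity [LHS]integral_mkcond.
apply: eq_integral => x _; rewrite patchE indicE.
by case: ifP => _; rewrite ?mule1 ?mule0.
Qed.

Section tensor_integral.
Context d (T : measurableType d) (R : realType).
Variable mu : {sigma_finite_measure set T -> \bar R}.

Lemma ge0_integral_tensorS n (f : n.+1.-tuple T -> \bar R) :
  measurable_fun setT f -> (forall t, 0 <= f t) ->
  \int[tensor mu n.+1]_t f t =
  \int[mu]_x \int[tensor mu n]_u f (tuple_cons (x, u)).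
Proof.
move=> mf f0.
rewrite [LHS](ge0_integral_pushforward (@measurable_tuple_cons _ T n))//.
rewrite preimage_setT fubini_tonelli1//=.
- by apply: measurableT_comp => //; exact: measurable_tuple_cons.
Qed.

Lemma ge0_integral_tensor0 (f : 0.-tuple T -> \bar R) :
  measurable_fun setT f -> \int[tensor mu 0]_t f t = f [tuple].
Proof. by move=> mf; rewrite [LHS]integral_dirac// diracT mul1e. Qed.

Definition tuple_remove n (i : 'I_n.+1) (t : n.+1.-tuple T) : n.-tuple T :=
  [tuple tnth t (lift i j) | j < n].

Lemma measurable_tuple_remove n (i : 'I_n.+1) :
  measurable_fun setT (tuple_remove i).
Proof.
apply/measurable_fun_tnthP => j.
rewrite (_ : _ \o _ = (@tnth _ T ^~ (lift i j))); first exact: measurable_tnth.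
by apply/funext => t /=; rewrite tnth_mktuple.
Qed.

Lemma measurable_pick n (i : 'I_n.+1) :
  measurable_fun setT (fun t : n.+1.-tuple T => (tnth t i, tuple_remove i t)).
Proof.
apply: measurable_fun_pair => /=; first exact: measurable_tnth.
exact: measurable_tuple_remove.
Qed.

Lemma tnth_tuple_cons0 n (x : T) (u : n.-tuple T) : tnth (tuple_cons (x, u)) ord0 = x.
Proof. by []. Qed.

Lemma tnth_tuple_consS n (x : T) (u : n.-tuple T) i :
  tnth (tuple_cons (x, u)) (lift ord0 i) = tnth u i.
Proof. by rewrite /tuple_cons tnthS. Qed.

Lemma tuple_remove0 n (x : T) (u : n.-tuple T) :
  tuple_remove ord0 (tuple_cons (x, u)) = u.
Proof.
by apply: eq_from_tnth => j; rewrite tnth_mktuple tnth_tuple_consS.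
Qed.

Lemma tuple_removeS n (x : T) (u : n.+1.-tuple T) i :
  tuple_remove (lift ord0 i) (tuple_cons (x, u)) =
  tuple_cons (x, tuple_remove i u).
Proof.
apply: eq_from_tnth => j; rewrite tnth_mktuple.
have [->|[k ->]] : j = ord0 \/ exists k, j = lift ord0 k.
  by case: (unliftP ord0 j) => [k ->|->]; [right; exists k|left].
  rewrite tnth_tuple_cons0 -[in RHS](tnth_tuple_cons0 x u); congr tnth.
  exact/val_inj.
rewrite tnth_tuple_consS tnth_mktuple -[RHS](tnth_tuple_consS x); congr tnth.
(* On values this is [bump i.+1 k.+1 = (bump i k).+1]. *)
by apply/val_inj => /=; rewrite /bump/= !add1n ltnS; case: leqP.
Qed.

Lemma measurable_tensor_integral d' (X : measurableType d') n
    (f : X * n.-tuple T -> \bar R) :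
  measurable_fun setT f -> (forall z, 0 <= f z) ->
  measurable_fun setT (fun x => \int[tensor mu n]_u f (x, u)).
Proof. by move=> mf f0; exact: measurable_fun_fubini_tonelli_F. Qed.

(** Product measures are exchangeable. Unless the first entry is picked, it is integrated apart, the
    induction hypothesis brings the picked entry to the front of the others, and Tonelli swaps these
    two coordinates. *)
Lemma ge0_integral_pick n (i : 'I_n.+1) (h : T * n.-tuple T -> \bar R) :
  measurable_fun setT h -> (forall z, 0 <= h z) ->
  \int[tensor mu n.+1]_t h (tnth t i, tuple_remove i t) =
  \int[mu]_x \int[tensor mu n]_u h (x, u).
Proof.
have unfoldS m (k : 'I_m.+1) (g : T * m.-tuple T -> \bar R) :
    measurable_fun setT g -> (forall z, 0 <= g z) ->
  \int[tensor mu m.+1]_t g (tnth t k, tuple_remove k t) =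
  \int[mu]_x \int[tensor mu m]_u
    g (tnth (tuple_cons (x, u)) k, tuple_remove k (tuple_cons (x, u))).
  move=> mg g0.
  have mgk : measurable_fun setT (fun t => g (tnth t k, tuple_remove k t)).
    by apply: (measurableT_comp mg); exact: measurable_pick.
  by have := ge0_integral_tensorS mgk (fun t => g0 _).
elim: n => [|n IH] in i h * => mh h0; rewrite (unfoldS _ i h mh h0).
  apply: eq_integral => x _; apply: eq_integral => u _.
  by rewrite (ord1 i) tnth_tuple_cons0 tuple_remove0.
case: (unliftP ord0 i) => [j ->|->]; last first.
  apply: eq_integral => x _; apply: eq_integral => u _.
  by rewrite tnth_tuple_cons0 tuple_remove0.
(* Here [q.1.1] is the first entry of the tuple and [q.1.2] the picked one. *)
pose g (q : (T * T) * n.-tuple T) := h (q.1.2, tuple_cons (q.1.1, q.2)).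
have mg : measurable_fun setT g.
  apply: (measurableT_comp mh); apply: measurable_fun_pair.
    exact: (measurableT_comp measurable_snd measurable_fst).
  apply: (measurableT_comp (@measurable_tuple_cons _ T n)).
  apply: measurable_fun_pair => //.
  exact: (measurableT_comp measurable_fst measurable_fst).
transitivity (\int[mu]_x \int[mu]_y \int[tensor mu n]_u g ((x, y), u)).
  apply: eq_integral => x _.
  have mx : measurable_fun setT (fun q : T * n.-tuple T => ((x, q.1), q.2)).
    by apply: measurable_fun_pair => //; exact: measurable_fun_pair.
  rewrite -(IH j _ (measurableT_comp mg mx) (fun=> h0 _)).
  apply: eq_integral => u _.
  by rewrite tnth_tuple_consS tuple_removeS.
have mG := measurable_tensor_integral mg (fun=> h0 _).
rewrite (fubini_tonelli _ mG) => [|q]; last by apply: integral_ge0 => u _; exact: h0.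
apply: eq_integral => x _; rewrite ge0_integral_tensorS//.
have mx : measurable_fun setT (fun u : n.+1.-tuple T => (x, u)).
  exact: measurable_fun_pair.
exact: (measurableT_comp mh mx).
Qed.

End tensor_integral.

(** * Selections of points of a tuple *)

Section selections.
Context d (T : measurableType d) (R : realType).

(* The integral of [f] against the [N]-th factorial measure of the entries of a
   tuple, as a finite sum that is visibly measurable in the tuple. *)
Fixpoint selection_sum N :
    (N.-tuple T -> R) -> forall M, M.-tuple T -> R :=
  match N with
  | 0 => fun f M _ => f [tuple]
  | N'.+1 => fun f M => match M return M.-tuple T -> R with
    | 0 => fun=> 0%R
    | M'.+1 => fun t => (\sum_(i < M'.+1)
        selection_sum (fun u => f (tuple_cons (tnth t i, u)))
          (tuple_remove i t))%R
    end
  end.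

Lemma selection_sum_ge0 N (f : N.-tuple T -> R) M (t : M.-tuple T) :
  (forall u, 0 <= f u)%R -> (0 <= selection_sum f t)%R.
Proof.
elim: N => [|N IH] in f M t * => f0 //=.
by case: M t => // M t; apply: sumr_ge0 => i _; exact: IH.
Qed.

Lemma measurable_selection_sum N d' (X : measurableType d')
    (f : X * N.-tuple T -> R) M : measurable_fun setT f ->
  measurable_fun setT (fun q : X * M.-tuple T =>
    selection_sum (fun u => f (q.1, u)) q.2).
Proof.
elim: N => [|N IH] in d' X f M * => mf /=.
  have mg : measurable_fun setT (fun q : X * M.-tuple T => (q.1, [tuple] : 0.-tuple T)).
    exact: measurable_fun_pair.
  exact: (measurableT_comp mf mg).
case: M => [|M]; first exact: measurable_cst.
apply: measurable_sum => i.
pose f' (q : (X * T) * N.-tuple T) := f (q.1.1, tuple_cons (q.1.2, q.2)).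
have mp : measurable_fun setT (fun q : (X * T) * N.-tuple T =>
    (q.1.1, tuple_cons (q.1.2, q.2))).
  apply: measurable_fun_pair.
    exact: (measurableT_comp measurable_fst measurable_fst).
  apply: (measurableT_comp (@measurable_tuple_cons _ T N)).
  apply: measurable_fun_pair => //.
  exact: (measurableT_comp measurable_snd measurable_fst).
have mf' : measurable_fun setT f' := measurableT_comp mf mp.
have mq : measurable_fun setT (fun q : X * M.+1.-tuple T =>
    ((q.1, tnth q.2 i), tuple_remove i q.2)).
  apply: measurable_fun_pair.
    apply: measurable_fun_pair => //.
    exact: (measurableT_comp (measurable_tnth i) measurable_snd).
  exact: (measurableT_comp (measurable_tuple_remove i) measurable_snd).
exact: (measurableT_comp (IH _ _ f' M mf') mq).
Qed.

Lemma esum_subset (A B : set T) (a : T -> \bar R) :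
  A `<=` B -> \esum_(x in A) a x <= \esum_(x in B) a x.
Proof.
move=> AB; apply: ge_ereal_sup => _ [X [finX XA] <-].
by apply: ereal_sup_ubound; exists X => //; split => //; exact: subset_trans AB.
Qed.

Lemma esum_seq (s : seq T) (a : T -> \bar R) : uniq s -> (forall x, 0 <= a x) ->
  \esum_(x in [set` s]) a x = \sum_(x <- s) a x.
Proof.
by move=> us a0; rewrite (esum_fset (finite_seq s) (fun x _ => a0 x)) -fsbig_seq.
Qed.

Lemma factorial_measure_ge0 N (g : set T) (A : set (N.-tuple T)) :
  0 <= factorial_measure R g A.
Proof.
elim: N => [|N IH] in g A *; first exact: measure_ge0.
by apply: esum_ge0 => x _; exact: IH.
Qed.

Lemma factorial_measure0 N (g : set T) :
  factorial_measure R g (set0 : set (N.-tuple T)) = 0 :> \bar R.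
Proof.
elim: N => [|N IH] in g *; first exact: measure0.
by apply: esum1 => x _; exact: IH.
Qed.

(** Although [g] may have infinitely many points outside [W], tuples of [A] have all their entries
    in [W]; so each sum of the recursion only sees the points of [g] in [W], which are entries of
    [t]. *)
Lemma factorial_measure_le_selection_sum N (W g : set T) (A : set (N.-tuple T))
    M (t : M.-tuple T) :
  uniq t -> g `&` W `<=` [set` t] ->
  (forall u, A u -> forall i, W (tnth u i)) ->
  factorial_measure R g A <= (selection_sum \1_A t)%:E.
Proof.
elim: N => [|N IH] in g A M t * => ut gt AW.
  by rewrite /= diracE indicE.
have -> : factorial_measure R g A =
    \esum_(x in g `&` W) factorial_measure R (g `\ x) [set u | A (tuple_cons (x, u))].
  rewrite esum_mkcondr; apply: eq_esum => x gx; case: ifPn => // /negP xW.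
  suff -> : [set u | A (tuple_cons (x, u))] = set0 by exact: factorial_measure0.
  apply/seteqP; split => // u /AW /(_ ord0); rewrite tnth_tuple_cons0 => Wx.
  by apply: xW; rewrite inE.
apply: (le_trans (esum_subset _ gt)).
rewrite esum_seq//; last by move=> x; exact: factorial_measure_ge0.
case: M => [|M] in t ut gt *; first by rewrite (tuple0 t) big_nil.
rewrite big_tuple [selection_sum _ _]/= -sumEFin; apply: lee_sum => i _.
rewrite (_ : (fun u => _) = \1_[set u | A (tuple_cons (tnth t i, u))]) //.
apply: IH.
- by rewrite map_inj_uniq ?enum_uniq// => j k /(tuple_uniqP _ ut) /lift_inj.
(* A remaining point in [W] is an entry of [t] other than the one at [i], so its index has the form
   [lift i j]. *)
- move=> y [[gy yi] Wy]; have /tnthP[k yE] := gt y (conj gy Wy).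
  have : k != i by apply/eqP => ki; apply: yi; rewrite yE ki.
  case: (unliftP i k) => [j kE _|-> /eqP//].
  by apply/tnthP; exists j; rewrite tnth_mktuple -kE.
- by move=> u Au j; have := AW _ Au (lift ord0 j); rewrite tnth_tuple_consS.
Qed.

End selections.

(** * Mecke's formula for weighted tuples *)

Section mecke.
Context d (T : measurableType d) (R : realType).
Variables (lam mu : {sigma_finite_measure set T -> \bar R}) (z : {posnum R}).
Variables (e : T -> \bar R) (c : T -> R) (w : forall M, M.-tuple T -> \bar R).
Hypotheses (me : measurable_fun setT e) (e0 : forall x, 0 <= e x).
Hypothesis mu_density : forall h, measurable_fun setT h -> (forall x, 0 <= h x) ->
  \int[mu]_x h x = z%:num%:E * \int[lam]_x (e x * h x).
Hypotheses (mc : measurable_fun setT c) (c0 : forall x, (0 <= c x)%R).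
Hypotheses (mw : forall M, measurable_fun setT (@w M))
  (w0 : forall M (t : M.-tuple T), 0 <= w t).
Hypothesis w_remove : forall M (i : 'I_M.+1) (t : M.+1.-tuple T),
  w t <= e (tnth t i) * (c (tnth t i))%:E * w (tuple_remove i t).

Let a M : R := (z%:num ^+ M / M`!%:R)%R.

Let a0 M : (0 <= a M)%R.
Proof. by rewrite divr_ge0// exprn_ge0. Qed.

(** The [M.+1] possible positions of a selected point reduce the weight of [M.+1] points to that of
    [M] points, up to a factor [z] that becomes part of [mu]. *)
Let aS M : (a M.+1 * M.+1%:R = z%:num * a M)%R.
Proof.
by rewrite /a factS mulnC natrM exprS invfM !mulrA divfK// pnatr_eq0.
Qed.

Let C N (u : N.-tuple T) : R := (\prod_(i < N) c (tnth u i))%R.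

Let C0 N (u : N.-tuple T) : (0 <= C u)%R.
Proof. by apply: prodr_ge0 => i _. Qed.

Let mC N : measurable_fun setT (@C N).
Proof.
apply: measurable_prod => i _; apply: (measurableT_comp mc).
exact: measurable_tnth.
Qed.

Let C_cons N x (u : N.-tuple T) : C (tuple_cons (x, u)) = (c x * C u)%R.
Proof.
rewrite /C big_ord_recl tnth_tuple_cons0; congr (_ * _)%R.
by apply: eq_bigr => i _; rewrite tnth_tuple_consS.
Qed.

(** Induction on [N]. For the first selected point [x], [w_remove] extracts [e x * c x], all
    positions contribute equally by [ge0_integral_pick], and [aS] with [mu_density] produces an
    integral against [mu]. The section of [f] at [x] is left to the induction hypothesis, with the
    same series on the right. *)
Lemma selection_sum_integral_le N (f : N.-tuple T -> R) :
  measurable_fun setT f -> (forall u, 0 <= f u)%R ->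
  \sum_(M <oo) (a M)%:E *
    \int[tensor lam M]_t ((selection_sum f t)%:E * w t) <=
  (\int[tensor mu N]_u (f u * C u)%:E) *
    \sum_(M <oo) (a M)%:E * \int[tensor lam M]_t w t.
Proof.
have int_w0 M : 0 <= \int[tensor lam M]_t w t by exact: integral_ge0.
have aw0 M : 0 <= (a M)%:E * \int[tensor lam M]_t w t.
  by rewrite mule_ge0// lee_fin.
have sw0 K (g : K.-tuple T -> R) M (t : M.-tuple T) : (forall u, 0 <= g u)%R ->
    0 <= (selection_sum g t)%:E * w t.
  by move=> g0; rewrite mule_ge0// lee_fin selection_sum_ge0.
have asw0 K (g : K.-tuple T -> R) M : (forall u, 0 <= g u)%R ->
    0 <= (a M)%:E * \int[tensor lam M]_t ((selection_sum g t)%:E * w t).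
  move=> g0; rewrite mule_ge0// ?lee_fin//.
  by apply: integral_ge0 => t _; exact: sw0.
elim: N f => [|N IH] f mf f0.
  have mfC : measurable_fun setT (fun u : 0.-tuple T => (f u * C u)%:E).
    by apply/measurable_EFinP; apply: measurable_funM => //; exact: mC.
  rewrite (ge0_integral_tensor0 mu mfC) {1}/C big_ord0 mulr1 -nneseriesZl//.
  apply: lee_nneseries => [M _ _|M _]; first exact: asw0.
  rewrite /= ge0_integralZl//; last 2 first.
  - exact: mw.
  - by rewrite lee_fin.
  by rewrite muleCA.
(* The integral over the [M] remaining entries once [x] has been selected. *)
pose J M x := \int[tensor lam M]_s
  ((selection_sum (fun u => f (tuple_cons (x, u))) s)%:E * w s).
have mp : measurable_fun setT (fun q : T * N.-tuple T => f (tuple_cons q)).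
  exact: (measurableT_comp mf (@measurable_tuple_cons _ T N)).
have mfx x : measurable_fun setT (fun u : N.-tuple T => f (tuple_cons (x, u))).
  exact: (measurableT_comp mp (pair1_measurable x)).
have mH M : measurable_fun setT (fun q : T * M.-tuple T =>
    (selection_sum (fun u => f (tuple_cons (q.1, u))) q.2)%:E * w q.2).
  apply: emeasurable_funM.
    apply/measurable_EFinP.
    exact: (measurable_selection_sum (f := fun q => f (tuple_cons q))).
  exact: (measurableT_comp (@mw M) measurable_snd).
have H0 M x (s : M.-tuple T) : 0 <=
    (selection_sum (fun u => f (tuple_cons (x, u))) s)%:E * w s.
  exact: sw0.
have mJ M : measurable_fun setT (J M).
  exact: (measurable_tensor_integral lam (mH M) (fun q => H0 M q.1 q.2)).
have J0 M x : 0 <= J M x by exact: integral_ge0.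
have mec : measurable_fun setT (fun x => e x * (c x)%:E).
  by apply: emeasurable_funM => //; apply/measurable_EFinP.
have ec0 x : 0 <= e x * (c x)%:E by rewrite mule_ge0// lee_fin.
have step M : (a M.+1)%:E *
    \int[tensor lam M.+1]_t ((selection_sum f t)%:E * w t) <=
    \int[mu]_x ((c x)%:E * ((a M)%:E * J M x)).
  pose h (q : T * M.-tuple T) := e q.1 * (c q.1)%:E *
    ((selection_sum (fun u => f (tuple_cons (q.1, u))) q.2)%:E * w q.2).
  have mh : measurable_fun setT h.
    apply: emeasurable_funM (mH M).
    exact: (measurableT_comp mec measurable_fst).
  have h0 q : 0 <= h q by rewrite mule_ge0.
  have intJ : \int[lam]_x \int[tensor lam M]_s h (x, s) =
      \int[lam]_x (e x * (c x)%:E * J M x).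
    apply: eq_integral => x _; rewrite /h/=.
    have mHx := measurableT_comp (mH M) (pair1_measurable x).
    exact: (ge0_integralZl _ measurableT mHx (fun s _ => H0 M x s) (ec0 x)).
  have -> : \int[mu]_x ((c x)%:E * ((a M)%:E * J M x)) =
      (a M.+1)%:E * (M.+1%:R%:E * \int[lam]_x \int[tensor lam M]_s h (x, s)).
    rewrite mu_density; last 2 first.
    - apply: emeasurable_funM; first exact/measurable_EFinP.
      by apply: emeasurable_funM.
    - by move=> x; rewrite !mule_ge0// lee_fin.
    rewrite intJ [RHS]muleA -EFinM aS [in RHS]EFinM -[RHS]muleA; congr (_ * _).
    have mecJ := emeasurable_funM mec (mJ M).
    rewrite -(ge0_integralZl _ measurableT mecJ) => [|x _|].
    - by apply: eq_integral => x _ /=; rewrite muleA muleCA.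
    - exact: mule_ge0.
    - by rewrite lee_fin.
  apply: lee_pmul => //; rewrite ?lee_fin//.
    by apply: integral_ge0 => t _; exact: sw0.
  apply: (@le_trans _ _ (\int[tensor lam M.+1]_t
      \sum_(i < M.+1) h (tnth t i, tuple_remove i t))).
    apply: le_lower_integral => [t|t]; first exact: sw0.
    rewrite /= -sumEFin ge0_sume_distrl; last first.
      by move=> i _; rewrite lee_fin selection_sum_ge0.
    apply: lee_sum => i _; rewrite /h/= muleCA; apply: lee_pmul => //.
    by rewrite lee_fin selection_sum_ge0.
  rewrite ge0_integral_sum//; last first.
    by move=> i; exact: (measurableT_comp mh (measurable_pick i)).
  under eq_bigr do rewrite (ge0_integral_pick lam _ mh h0).
  have -> : M.+1%:R%:E = \sum_(i < M.+1) 1 :> \bar R.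
    by rewrite sumEFin sumr_const card_ord.
  rewrite ge0_sume_distrl//; apply: lee_sum => i _; by rewrite mul1e.
(* No point can be selected when [M = 0], so this term vanishes; shifting the rest of the series by
   one matches [step]. *)
rewrite nneseries_recl//; last by move=> M _; exact: (asw0 N.+1 f M f0).
rewrite -(nneseries_addn 1 (fun M => asw0 N.+1 f M f0)) /=.
rewrite [X in (a 0)%:E * X]integral0_eq => [|t _]; last exact: mul0e.
rewrite mule0 add0e.
apply: (@le_trans _ _ (\sum_(M <oo) \int[mu]_x ((c x)%:E * ((a M)%:E * J M x)))).
  apply: lee_nneseries => [M _ _|M _]; rewrite addn1; last exact: step.
  exact: (asw0 N.+1 f M.+1 f0).
have mcJ M : measurable_fun setT (fun x => (c x)%:E * ((a M)%:E * J M x)).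
  by apply: emeasurable_funM; [exact/measurable_EFinP|exact: emeasurable_funM].
rewrite -integral_nneseries//; last first.
  by move=> M x _; rewrite !mule_ge0// lee_fin.
set Z := \sum_(M <oo) _ in IH *.
have Z0 : 0 <= Z by exact: nneseries_ge0.
have mfC K (f' : K.-tuple T -> R) : measurable_fun setT f' ->
    measurable_fun setT (fun u : K.-tuple T => (f' u * C u)%:E).
  by move=> ?; apply/measurable_EFinP; apply: measurable_funM => //; exact: mC.
have fC0 (u : N.+1.-tuple T) : 0 <= (f u * C u)%:E by rewrite lee_fin mulr_ge0.
have mG : measurable_fun setT (fun x =>
    \int[tensor mu N]_u (f (tuple_cons (x, u)) * C (tuple_cons (x, u)))%:E).
  apply: (measurable_tensor_integral mu
    (f := fun q => (f (tuple_cons q) * C (tuple_cons q))%:E)) => [|q].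
    exact: (measurableT_comp (mfC _ _ mf) (@measurable_tuple_cons _ T N)).
  exact: fC0.
rewrite (ge0_integral_tensorS mu (mfC _ _ mf) fC0).
rewrite -(ge0_integralZr _ measurableT mG) => [|x _|//]; last exact: integral_ge0.
apply: le_lower_integral => [x|x].
  by apply: nneseries_ge0 => M _ _; rewrite !mule_ge0// lee_fin.
(* For fixed [x] the factor [c x] comes out of both sides, which leaves the induction hypothesis. *)
rewrite nneseriesZl; last by move=> M _; rewrite mule_ge0// lee_fin.
have -> : \int[tensor mu N]_u (f (tuple_cons (x, u)) * C (tuple_cons (x, u)))%:E =
    (c x)%:E * \int[tensor mu N]_u (f (tuple_cons (x, u)) * C u)%:E.
  rewrite -(ge0_integralZl _ measurableT (mfC _ _ (mfx x))) => [|u _|].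
  - by apply: eq_integral => u _; rewrite C_cons -EFinM mulrCA.
  - by rewrite lee_fin mulr_ge0.
  - by rewrite lee_fin.
rewrite -muleA; apply: lee_pmul => //; rewrite ?lee_fin//.
  by apply: nneseries_ge0 => M _ _; rewrite !mule_ge0// lee_fin.
exact: IH.
Qed.

End mecke.

(** * Symmetric functions of finite configurations *)

Section config_measurability.
Context d (T : measurableType d) (R : realType).

Lemma card_config (g : set T) n : (g #= `I_n)%card ->
  [/\ [set` fset_set g] = g, uniq (fset_set g) & size (fset_set g) = n].
Proof.
move=> gn; split => //; last exact: card_fset_set.
by apply: fset_setK; exists n.
Qed.

Definition config_measure n (g : config T) : {measure set T -> \bar R} :=
  msum (fun i => \d_(nth point (fset_set g) i))
    (if `[< (g #= `I_n)%card >] then n else 0%N).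

Lemma sum_fset_set (g : config T) n (f : T -> \bar R) : (g #= `I_n)%card ->
  \sum_(i < n) f (nth point (fset_set g) i) = \sum_(x <- fset_set g) f x.
Proof. by move=> /card_config[_ _ sg]; rewrite (big_nth point) sg big_mkord. Qed.

Lemma integral_config_measure n (g : config T) (f : T -> \bar R) :
  measurable_fun setT f -> (forall x, 0 <= f x) ->
  \int[config_measure n g]_x f x =
  if `[< (g #= `I_n)%card >] then \sum_(x <- fset_set g) f x else 0.
Proof.
move=> mf f0; rewrite ge0_integral_measure_sum//.
case: asboolP => gn; last by rewrite big_ord0.
rewrite -(sum_fset_set _ gn); apply: eq_bigr => i _.
by rewrite integral_dirac// diracT mul1e.
Qed.

Let dirac_measureE (x : T) B :
  (\d_x : {measure set T -> \bar R}) B = (x \in B)%:R%:E.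
Proof. exact: diracE. Qed.

Lemma config_measure_le n (g : config T) B : config_measure n g B <= n%:R%:E.
Proof.
rewrite /config_measure/= /msum.
have -> : n%:R%:E = \sum_(i < n) 1 :> \bar R.
  by rewrite sumEFin sumr_const card_ord.
case: asboolP => _; last by rewrite big_ord0 sume_ge0.
by apply: lee_sum => i _; rewrite dirac_measureE lee_fin; case: (_ \in _).
Qed.

Let count_event n k (B : set T) : set (config T) :=
  [set g | (g #= `I_n)%card] `&` [set g | (g `&` B #= `I_k)%card].

Lemma measurable_card_config n : measurable [set g : config T | (g #= `I_n)%card].
Proof.
apply: sub_sigma_algebra; exists setT => //; exists n.
by apply/seteqP; split => g /=; rewrite setIT.
Qed.

(** On configurations of [n] points the mass of [B] equals [k] on the event that exactly [k] points
    lie in [B]. These events generate the sigma-algebra, so the mass is a finite combination of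
    measurable indicators. *)
Lemma measurable_config_measure n (B : set T) : measurable B ->
  measurable_fun setT (fun g : config T => config_measure n g B).
Proof.
move=> mB.
have mE k : measurable (count_event n k B).
  apply: measurableI; first exact: measurable_card_config.
  by apply: sub_sigma_algebra; exists B => //; exists k.
rewrite (_ : (fun g => _) =
    (fun g => \sum_(k < n.+1) (k%:R * \1_(count_event n k B) g)%:E)).
  apply: emeasurable_sum => k; apply/measurable_EFinP.
  by apply: measurable_funM => //; exact: measurable_indic.
apply/funext => g; rewrite /config_measure/= /msum; case: asboolP => gn; last first.
  rewrite big_ord0 big1// => k _; rewrite indicE memNset ?mulr0//.
  by move=> [].
have [gE ug sg] := card_config gn.
rewrite (sum_fset_set (fun x => (\d_x : {measure set T -> \bar R}) B) gn).
pose k := count (fun x => x \in B) (fset_set g).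
have kn : (k < n.+1)%N by rewrite ltnS -sg count_size.
(* Only the index that counts the atoms of [g] in [B] gives a nonzero indicator. *)
rewrite (bigD1 (Ordinal kn))//= [X in _ + X]big1 ?adde0; last first.
  move=> j jk; rewrite indicE memNset ?mulr0// => -[_] /=.
  rewrite -gE => /card_seqI - /(_ ug) kj; case/eqP: jk; exact/val_inj.
rewrite indicE mem_set ?mulr1; last first.
  by split => //=; rewrite -{1}gE; apply/card_seqI.
rewrite /k -sum1_count natr_sum big_mkcond/= -sumEFin [RHS]big_mkcond/=.
by apply: eq_bigr => x _; rewrite dirac_measureE; case: (_ \in _).
Qed.

End config_measurability.

Section config_kernel.
Context d d' (T : measurableType d) (X : measurableType d') (R : realType).
Variables (n : nat) (p : X -> config T) (mp : measurable_fun setT p).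

Definition config_kernel (_ : measurable_fun setT p) (x : X) :
  {measure set T -> \bar R} := config_measure R n (p x).

Let config_kernel_measurable U : measurable U ->
  measurable_fun setT (config_kernel mp ^~ U).
Proof. by move=> mU; exact: (measurableT_comp (measurable_config_measure n mU) mp). Qed.

HB.instance Definition _ := isKernel.Build _ _ _ _ _ (config_kernel mp)
  config_kernel_measurable.

Let config_kernel_uub : measure_fam_uub (config_kernel mp).
Proof.
exists n.+1%:R => x; apply: le_lt_trans (config_measure_le R n (p x) setT) _.
by rewrite lte_fin ltr_nat.
Qed.

HB.instance Definition _ := Kernel_isFinite.Build _ _ _ _ _ (config_kernel mp)
  config_kernel_uub.

Lemma measurable_integral_config_measure (f : X * T -> \bar R) :
  measurable_fun setT f -> (forall q, 0 <= f q) ->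
  measurable_fun setT (fun x => \int[config_measure R n (p x)]_y f (x, y)).
Proof.
move=> mf f0; exact: (measurable_fun_integral_finite_kernel _ (config_kernel mp)).
Qed.

End config_kernel.

Section config_integral.
Context d (T : measurableType d) (R : realType).

(* The integral of [f] against the [N]-th power of the counting measure of a
   configuration with exactly [n] points; for [N > 0] it is [0] on the other
   configurations, so that the counting measures form a bounded kernel. *)
Fixpoint config_integral n N : (N.-tuple T -> \bar R) -> config T -> \bar R :=
  match N with
  | 0 => fun f _ => f [tuple]
  | N'.+1 => fun f g => \int[config_measure R n g]_x
      config_integral n (fun u : N'.-tuple T => f (tuple_cons (x, u))) g
  end.

Lemma config_integral_ge0 n N (f : N.-tuple T -> \bar R) (g : config T) :
  (forall u, 0 <= f u) -> 0 <= config_integral n f g.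
Proof.
elim: N => [|N IH] in f * => f0 //=.
by apply: integral_ge0 => x _; exact: IH.
Qed.

(** The parameter space [X] is arbitrary because each step of the induction moves one integration
    variable into the parameters. *)
Lemma measurable_config_integral n N d' (X : measurableType d')
    (p : X -> config T) (f : X * N.-tuple T -> \bar R) :
  measurable_fun setT p -> measurable_fun setT f -> (forall q, 0 <= f q) ->
  measurable_fun setT (fun x => config_integral n (fun u => f (x, u)) (p x)).
Proof.
elim: N => [|N IH] in d' X p f * => mp mf f0 /=.
  have mg : measurable_fun setT (fun x : X => (x, [tuple] : 0.-tuple T)).
    exact: measurable_fun_pair.
  exact: (measurableT_comp mf mg).
have mq : measurable_fun setT (fun q : (X * T) * N.-tuple T =>
    (q.1.1, tuple_cons (q.1.2, q.2))).
  apply: measurable_fun_pair.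
    exact: (measurableT_comp measurable_fst measurable_fst).
  apply: (measurableT_comp (@measurable_tuple_cons _ T N)).
  apply: measurable_fun_pair => //.
  exact: (measurableT_comp measurable_snd measurable_fst).
have mI := IH _ _ (fun q : X * T => p q.1) _ (measurableT_comp mp measurable_fst)
  (measurableT_comp mf mq) (fun=> f0 _).
apply: (measurable_integral_config_measure n mp mI) => q.
by apply: config_integral_ge0 => u; exact: f0.
Qed.

Let measurable_config_integral_cons n N (f : N.+1.-tuple T -> \bar R) g :
  measurable_fun setT f -> (forall u, 0 <= f u) ->
  measurable_fun setT (fun x =>
    config_integral n (fun u : N.-tuple T => f (tuple_cons (x, u))) g).
Proof.
move=> mf f0.
exact: (measurable_config_integral n (measurable_cst g)
  (measurableT_comp mf (@measurable_tuple_cons _ T N)) (fun=> f0 _)).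
Qed.

Lemma config_integralS n N (f : N.+1.-tuple T -> \bar R) (g : config T) :
  (g #= `I_n)%card -> measurable_fun setT f -> (forall u, 0 <= f u) ->
  config_integral n f g = \sum_(x <- fset_set g)
    config_integral n (fun u : N.-tuple T => f (tuple_cons (x, u))) g.
Proof.
move=> gn mf f0 /=; rewrite integral_config_measure ?asboolT//.
  exact: measurable_config_integral_cons.
by move=> x; exact: config_integral_ge0.
Qed.

Let measurable_section n (f : n.+1.-tuple T -> \bar R) x :
  measurable_fun setT f ->
  measurable_fun setT (fun u : n.-tuple T => f (tuple_cons (x, u))).
Proof.
move=> mf; exact: (measurableT_comp
  (measurableT_comp mf (@measurable_tuple_cons _ T n)) (pair1_measurable x)).
Qed.

Let all_tuple_cons (g : config T) n x (u : n.-tuple T) :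
  atoms g x -> (forall i, atoms g (tnth u i)) ->
  forall i, atoms g (tnth (tuple_cons (x, u)) i).
Proof.
move=> gx gu i; case: (unliftP ord0 i) => [j ->|->]; last exact: gx.
by rewrite tnth_tuple_consS; exact: gu.
Qed.

(** The counting measure of [g] only charges atoms, so proportionality on tuples of atoms is
    enough. *)
Lemma config_integral_eqZ n N (f h : N.-tuple T -> \bar R) (C : \bar R)
    (g : config T) : (g #= `I_n)%card ->
  measurable_fun setT f -> (forall u, 0 <= f u) ->
  measurable_fun setT h -> (forall u, 0 <= h u) ->
  (forall u, (forall i, atoms g (tnth u i)) -> f u = C * h u) ->
  config_integral n f g = C * config_integral n h g.
Proof.
move=> gn; elim: N => [|N IH] in f h * => mf f0 mh h0 fh.
  by apply: fh => -[].
have [gE _ _] := card_config gn.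
rewrite !config_integralS// ge0_sume_distrr; last first.
  by move=> x _; exact: config_integral_ge0.
rewrite big_seq [RHS]big_seq; apply: eq_bigr => x xg.
have gx : atoms g x by rewrite -gE.
apply: IH => //; [exact: measurable_section|exact: measurable_section|].
by move=> u gu; apply: fh; exact: all_tuple_cons.
Qed.

Lemma le_config_integral n N (f : N.-tuple T -> \bar R) (g : config T) u :
  (g #= `I_n)%card -> measurable_fun setT f -> (forall u, 0 <= f u) ->
  (forall i, atoms g (tnth u i)) -> f u <= config_integral n f g.
Proof.
move=> gn; elim: N => [|N IH] in f u * => mf f0 gu; first by rewrite (tuple0 u).
have [gE ug _] := card_config gn.
have u0 : tnth u ord0 \in fset_set g by have := gu ord0; rewrite -{1}gE.
rewrite config_integralS// (big_rem (tnth u ord0))//=.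
rewrite -[leLHS]adde0; apply: leeD; last first.
  by apply: sume_ge0 => x _; exact: config_integral_ge0.
have -> : u = tuple_cons (tnth u ord0, [tuple of behead u]) by exact: tuple_eta.
rewrite tnth_tuple_cons0.
apply: (IH (fun v => f (tuple_cons (tnth u ord0, v)))) => //.
  exact: measurable_section.
by move=> i; rewrite tnth_behead; exact: gu.
Qed.

(** Finiteness of this count permits the division in [measurable_symmetric]. *)
Lemma config_integral_indic_fin n N (D : set (N.-tuple T)) (g : config T) :
  measurable D -> config_integral n (fun u => (\1_D u)%:E) g \is a fin_num.
Proof.
elim: N => [|N IH] in D * => mD //.
have [gn|gn] := pselect (g #= `I_n)%card; last first.
  rewrite /= integral_config_measure ?asboolF//.
    apply: (@measurable_config_integral_cons n N (fun u => (\1_D u)%:E)) => //.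
    by apply/measurable_EFinP; exact: measurable_indic.
  by move=> x; apply: config_integral_ge0 => u; rewrite lee_fin.
rewrite config_integralS//; last first.
  by apply/measurable_EFinP; exact: measurable_indic.
rewrite sum_fin_num; apply/allP => _ /mapP[x _ ->].
apply: (IH [set u | D (tuple_cons (x, u))]).
rewrite -[X in measurable X]setTI.
exact: (measurableT_comp (@measurable_tuple_cons _ T N) (pair1_measurable x)).
Qed.

Section symmetric.
Variables (D : forall n, set (n.-tuple T)) (phi : config T -> \bar R).
Hypotheses (mD : forall n, measurable (@D n)) (uD : forall n t, @D n t -> uniq t).
Hypothesis phi0 : forall g, 0 <= phi g.
Hypothesis mphi : forall n, measurable_fun setT
  (fun t : n.-tuple T => (\1_(@D n) t)%:E * phi (config_of_seq t)).

(** Positivity of the integral expresses, in a visibly measurable way, that some [n]-tuple of atoms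
    lies in [D]. *)
Definition enumerated n : set (config T) :=
  [set g : config T | (g #= `I_n)%card] `&`
  [set g | 0 < config_integral n (fun t => (\1_(@D n) t)%:E) g].

Let measurable_one n : measurable_fun setT (fun t => (\1_(@D n) t)%:E : \bar R).
Proof. by apply/measurable_EFinP; apply: measurable_indic; exact: mD. Qed.

Lemma measurable_enumerated n : measurable (enumerated n).
Proof.
apply: measurableI; first exact: measurable_card_config.
rewrite -[X in measurable X]setTI; apply: emeasurable_fun_o_infty => //.
apply: (measurable_config_integral n (p := id)
  (f := fun q => (\1_(@D n) q.2)%:E)) => //.
  exact: (measurableT_comp (@measurable_one n) measurable_snd).
Qed.

Lemma config_of_seq_enumerated n (t : n.-tuple T) :
  D t -> enumerated n (config_of_seq t).
Proof.
move=> Dt; have tn : (config_of_seq t #= `I_n)%card.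
  rewrite -[X in (X #= _)%card]setIT; apply/card_seqI; first exact: uD Dt.
  by rewrite (@eq_count _ _ xpredT) ?count_predT ?size_tuple// => x; rewrite in_setT.
split => //=; apply: (@lt_le_trans _ _ (\1_(@D n) t)%:E).
  by rewrite indicE mem_set.
apply: (le_config_integral tn (@measurable_one n)) => i; first by rewrite lee_fin.
exact: mem_tnth.
Qed.

(* On a configuration [g] of [n] points, integrating [\1_D * phi] over [n]-tuples
   only charges the enumerations of [g], where [phi] equals [phi g]: so [phi] is
   the quotient of two measurable integrals. *)
Lemma measurable_symmetric :
  measurable_fun (\bigcup_n enumerated n) phi.
Proof.
apply/measurable_fun_bigcup => n; first exact: measurable_enumerated.
pose one t := (\1_(@D n) t)%:E : \bar R.
pose f t := one t * phi (config_of_seq t).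
have m1 : measurable_fun setT one by exact: measurable_one.
have one0 t : 0 <= one t by rewrite lee_fin.
have f0 t : 0 <= f t by exact: mule_ge0.
have mf' : measurable_fun setT f by exact: mphi.
have mI (h : n.-tuple T -> \bar R) : measurable_fun setT h -> (forall u, 0 <= h u) ->
    measurable_fun setT (config_integral n h).
  move=> mh h0; apply: (measurable_config_integral n (p := id)
    (f := fun q => h q.2)) => //.
  exact: (measurableT_comp mh measurable_snd).
(* The exponent [-1] gives the inverse, since the count is finite and positive on [enumerated n]. *)
suff : measurable_fun setT (fun g =>
    ((fine (config_integral n one g)) `^ (-1))%:E * config_integral n f g).
  move=> mf; apply: eq_measurable_fun (measurable_funTS mf) => g /set_mem[gn g_gt0].
  have g0 : 0 < config_integral n one g := g_gt0.
  have gfin : config_integral n one g \is a fin_num.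
    exact: config_integral_indic_fin.
  have c0 : (0 < fine (config_integral n one g))%R.
    by apply: fine_gt0; apply/andP; split => //; rewrite ltey_eq gfin.
  have fE : config_integral n f g = phi g * config_integral n one g.
    apply: (config_integral_eqZ gn mf' f0 m1 one0) => t gt.
    rewrite /f /one [RHS]muleC; have [/set_mem Dt|Dt] := boolP (t \in @D n); last first.
      by rewrite indicE (negbTE Dt) !mul0e.
    congr (_ * phi _); apply: config_eq => /=.
    have [gE ug sg] := card_config gn.
    (* A tuple of [n] atoms without repetition exhausts a configuration of [n] points. *)
    have sub : {subset t <= fset_set g}.
      by move=> x /tnthP[i ->]; have := gt i; rewrite -{1}gE.
    have size_le : (size (fset_set g) <= size t)%N by rewrite size_tuple sg.
    have [_ tg] := uniq_min_size (uD Dt) sub size_le.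
    by rewrite -gE; apply/seteqP; split => x /=; rewrite tg.
  rewrite fE powR_inv1 ?fine_ge0 ?config_integral_ge0// muleCA.
  rewrite -[config_integral n one g in X in _ * X](fineK gfin).
  by rewrite -EFinM mulVf ?mule1// gt_eqF.
apply: emeasurable_funM; last exact: mI.
apply/measurable_EFinP; apply: (measurableT_comp (measurable_powR _)).
apply: (measurableT_comp (fine_measurable _)) => //; exact: mI.
Qed.

End symmetric.
End config_integral.

(** * Energies *)

Section energies.
Context d (T : measurableType d) (R : realType).
Variables (Psi : potential T R) (Phi : potential (T * T)%type R).
Hypothesis Phi_sym : forall x y, Phi (x, y) = Phi (y, x).

Fixpoint pair_sum (s : seq T) : \bar R :=
  if s is x :: s' then \sum_(y <- s') Phi (x, y) + pair_sum s' else 0.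

Lemma pair_sum_nth (s : seq T) :
  pair_sum s = \sum_(i < size s) \sum_(j < size s | (i < j)%N)
    Phi (nth point s i, nth point s j).
Proof.
elim: s => [|x s IH] /=; first by rewrite big_ord0.
rewrite big_ord_recl IH; congr (_ + _).
  rewrite [RHS]big_mkcond [RHS]big_ord_recl/= add0e (big_nth point) big_mkord.
  by apply: eq_bigr => i _.
apply: eq_bigr => i _; rewrite [RHS]big_mkcond big_ord_recl/= add0e.
by rewrite big_mkcond; apply: eq_bigr => j _; rewrite /bump !add1n.
Qed.

Lemma pair_sum_cat s1 x s2 :
  pair_sum (s1 ++ x :: s2) =
  \sum_(y <- s1 ++ s2) Phi (x, y) + pair_sum (s1 ++ s2).
Proof.
elim: s1 => [//|y s1 IH] /=; rewrite IH big_cons.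
have -> : \sum_(z <- s1 ++ x :: s2) Phi (y, z) =
    Phi (x, y) + \sum_(z <- s1 ++ s2) Phi (y, z).
  by rewrite !big_cat/= big_cons (Phi_sym x) addeCA.
exact: addeACA.
Qed.

(** The enumeration chosen by [fset_set] need not follow the order of a given tuple; the symmetry of
    [Phi] reconciles the two. *)
Lemma perm_pair_sum s1 s2 : perm_eq s1 s2 -> pair_sum s1 = pair_sum s2.
Proof.
elim: s1 s2 => [|x s1 IH] s2 s12; first by move: s12; rewrite perm_sym => /perm_nilP ->.
have : x \in s2 by rewrite -(perm_mem s12) mem_head.
move=> xs2; case/splitPr: xs2 s12 => p q.
rewrite perm_sym -[x :: q]cat1s perm_catCA /= perm_cons perm_sym => s12.
by rewrite pair_sum_cat /= (IH _ s12) (perm_big _ s12).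
Qed.

Lemma pair_energy_config_of_seq (s : seq T) : uniq s ->
  pair_energy Phi (config_of_seq s) = pair_sum s.
Proof.
move=> us; rewrite /pair_energy -pair_sum_nth; apply: perm_pair_sum.
apply: uniq_perm => [||x]; [exact: fset_uniq|exact: us|].
rewrite in_fset_set; last exact: finite_seq.
by apply/idP/idP => [/set_mem//|xs]; exact/mem_set.
Qed.

Variable eta : config T.

Definition seq_energy (s : seq T) : \bar R :=
  \sum_(x <- s) (Psi x + point_energy Phi x eta) + pair_sum s.

Lemma energy_config_of_seq (s : seq T) : uniq s ->
  energy Psi Phi (config_of_seq s) + cond_energy Phi (config_of_seq s) eta =
  seq_energy s.
Proof.
move=> us; rewrite /energy /cond_energy pair_energy_config_of_seq//.
have fs (F : T -> \bar R) : \sum_(x \in config_of_seq s) F x = \sum_(x <- s) F x.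
  by rewrite [RHS](fsbig_seq _ _ us).
by rewrite !fs addeAC -big_split.
Qed.

Lemma perm_seq_energy s1 s2 : perm_eq s1 s2 -> seq_energy s1 = seq_energy s2.
Proof.
by move=> s12; rewrite /seq_energy (perm_big _ s12) (perm_pair_sum s12).
Qed.

(** This isolates the energy of [x] given both the other points and [eta], the quantity to be
    bounded below when a point is removed. *)
Lemma seq_energy_cons x s : seq_energy (x :: s) =
  Psi x + (\sum_(y <- s) Phi (x, y) + point_energy Phi x eta) + seq_energy s.
Proof.
rewrite /seq_energy big_cons/= addeACA; congr (_ + _).
by rewrite -addeA; congr (_ + _); exact: addeC.
Qed.

(** By the convention [+oo - +oo = -oo], a divergent sum of negative parts would make the energy
    [-oo]. *)
Lemma point_energyNy x : -oo < point_energy Phi x eta ->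
  \esum_(y in eta) maxe (- Phi (x, y)) 0 \is a fin_num.
Proof.
rewrite /point_energy ge0_fin_numE; last first.
  by apply: esum_ge0 => y _; rewrite le_max lexx orbT.
by rewrite ltey; apply: contraTneq => ->; case: (esum _ _).
Qed.

(** Positive and negative parts split separately over the two disjoint pieces; the negative part
    over [eta] is finite, so the differences can be regrouped. *)
Lemma point_energy_union x s : uniq s -> (forall y, y \in s -> ~ atoms eta y) ->
  -oo < point_energy Phi x eta ->
  point_energy Phi x (config_union (config_of_seq s) eta) =
  \sum_(y <- s) Phi (x, y) + point_energy Phi x eta.
Proof.
move=> us s_eta eta_fin.
have split_union (a : T -> \bar R) : (forall y, 0 <= a y) ->
    \esum_(y in config_union (config_of_seq s) eta) a y =
    \sum_(y <- s) a y + \esum_(y in eta) a y.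
  move=> a0; rewrite (esumID [set` s])// -esum_seq//; congr (_ + _).
    by congr (esum _ _); apply/seteqP; split => y /=; [case|split => //; left].
  congr (esum _ _); apply/seteqP; split => y /=; first by case=> -[].
  by move=> ey; split; [right|move=> /s_eta].
rewrite /point_energy !split_union; try by move=> y; rewrite le_max lexx orbT.
rewrite fin_num_oppeD ?point_energyNy// addeACA; congr (_ + _).
have nfin y : maxe (- Phi (x, y)) 0 \is a fin_num.
  have := potential_gtNy Phi (x, y); case: (Phi _) => //= [r|] _.
    by rewrite -EFin_max.
  by rewrite max_r.
(* For the finite part, each value is its positive part minus its finite negative part. *)
elim: s {us s_eta split_union} => [|y s IH]; first by rewrite !big_nil oppe0 adde0.
rewrite !big_cons -IH fin_num_oppeD; last first.
  by rewrite sum_fin_num; apply/allP => _ /mapP[y' _ ->]; exact: nfin.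
rewrite addeACA; congr (_ + _).
have := potential_gtNy Phi (x, y); case: (Phi _) => //= [r|] _.
  rewrite -!EFin_max -EFinN -EFinD; congr EFin; have /orP[r0|r0] := le_total 0%R r.
    by rewrite max_l// max_r ?oppr_le0// subr0.
  by rewrite max_r// max_l ?oppr_ge0// sub0r opprK.
by rewrite max_l// max_r// oppe0 adde0.
Qed.

(** As [eta] is countable, an injection into the natural numbers turns both sums into series of
    measurable functions. *)
Lemma measurable_point_energy :
  measurable_fun setT (fun x => point_energy Phi x eta).
Proof.
have [f finj] := countable_injP _ (countable_atoms eta).
have fbij : set_bij (f @` atoms eta) (atoms eta)
    ('pinv_(fun=> point) (atoms eta) f) by exact: injpinv_bij.
have mesum (a : T * T -> \bar R) : measurable_fun setT a -> (forall q, 0 <= a q) ->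
    measurable_fun setT (fun x => \esum_(y in eta) a (x, y)).
  move=> ma a0.
  rewrite (_ : (fun x => _) = fun x => \sum_(n <oo | n \in f @` atoms eta)
      a (x, 'pinv_(fun=> point) (atoms eta) f n)).
    apply: ge0_emeasurable_sum => // n _.
    exact: (measurableT_comp ma (pair2_measurable _)).
  apply/funext => x; rewrite (reindex_esum _ _ _ _ fbij).
  rewrite nneseries_esum//; congr (esum _ _).
  by apply/seteqP; split => n /=; rewrite inE.
have mPhi := measurable_potential Phi.
apply: emeasurable_funB.
- apply: (mesum (fun q => maxe (Phi q) 0)) => [|q].
    exact: measurable_maxe.
  by rewrite le_max lexx orbT.
- apply: (mesum (fun q => maxe (- Phi q) 0)) => [|q].
    apply: measurable_maxe => //; exact: measurableT_comp.
  by rewrite le_max lexx orbT.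
Qed.

Lemma measurable_seq_energy n :
  measurable_fun setT (fun t : n.-tuple T => seq_energy t).
Proof.
have mV : measurable_fun setT (fun x => Psi x + point_energy Phi x eta).
  apply: emeasurable_funD; first exact: measurable_potential.
  exact: measurable_point_energy.
rewrite (_ : (fun t => _) = fun t : n.-tuple T =>
    \sum_(i < n) (Psi (tnth t i) + point_energy Phi (tnth t i) eta) +
    \sum_(i < n) \sum_(j < n | (i < j)%N) Phi (tnth t i, tnth t j)).
  apply: emeasurable_funD.
    apply: emeasurable_sum => i; exact: (measurableT_comp mV (measurable_tnth i)).
  apply: emeasurable_sum => i.
  under eq_fun do rewrite big_mkcond/=.
  apply: emeasurable_sum => j; case: (i < j)%N => //.
  apply: (measurableT_comp (measurable_potential Phi)).
  by apply: measurable_fun_pair; exact: measurable_tnth.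
apply/funext => t; rewrite /seq_energy big_tuple pair_sum_nth; congr (_ + _).
rewrite size_tuple; apply: eq_bigr => i _; apply: eq_bigr => j _.
by rewrite -!tnth_nth.
Qed.

End energies.

(** * Boltzmann weights of tuples in a window *)

Section weights.
Context (R : realType) (n : nat) (S : normedModType R).
Local Notation E := (marked_space n S).
Variables (Q : probability (marks S) R) (Psi : potential E R)
  (Phi : potential (E * E)%type R) (z beta : {posnum R}) (L : set (Rd R n)).
Hypothesis Phi_sym : forall x y, Phi (x, y) = Phi (y, x).
Hypothesis mL : measurable L.

Lemma boltzmann_le (a b : \bar R) : a <= b -> boltzmann beta b <= boltzmann beta a.
Proof. by move=> ab; rewrite /boltzmann lee_expeR leeN2 lee_pmul2l. Qed.

Lemma boltzmannD (a b : \bar R) : -oo < a -> -oo < b ->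
  boltzmann beta (a + b) = boltzmann beta a * boltzmann beta b.
Proof.
move=> aNy bNy; rewrite /boltzmann muleDr//; last exact: ltninfty_adde_def.
have scale c : -oo < c -> -oo < beta%:num%:E * c.
  by case: c => [c||]// _; [exact: ltNyr|rewrite gt0_muley ?lte_fin].
by rewrite oppeD ?expeRD//; apply: ltninfty_adde_def; exact: scale.
Qed.

Lemma gtNy_adde (a b : \bar R) : -oo < a -> -oo < b -> -oo < a + b.
Proof. exact: (@lteD _ -oo a -oo b). Qed.

Lemma distinct_sites_uniq M (t : M.-tuple E) : distinct_sites t -> uniq t.
Proof.
move=> Dt; apply/tuple_uniqP => i j tij; apply/eqP; apply: contraT => ij.
by case: (Dt i j ij); rewrite tij.
Qed.

Definition tuples_in M : set (M.-tuple E) :=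
  distinct_sites (N := M) `&` [set t | forall i, window L (tnth t i)].
Arguments tuples_in : clear implicits.

Lemma measurable_window : measurable (window L : set E).
Proof. by rewrite -[X in measurable X]setTI; exact: measurable_fst. Qed.

Lemma measurable_tuples_in M : measurable (tuples_in M).
Proof.
apply: measurableI; first exact: measurable_distinct_sites.
rewrite (_ : [set t | _] =
    \bigcap_(i in [set: 'I_M]) (@tnth _ E ^~ i @^-1` window L)).
  apply: fin_bigcap_measurable => // i _.
  by rewrite -[X in measurable X]setTI; apply: measurable_tnth => //; exact: measurable_window.
by apply/seteqP; split => t h i; [move=> _; exact: h|exact: (h i I)].
Qed.

Lemma config_of_seq_in M (t : M.-tuple E) :
  configs_in (window L) (config_of_seq t) <-> forall i, window L (tnth t i).
Proof.
split => [tL i|tL x /tnthP[i ->]]; last exact: tL.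
by apply: tL; exact: mem_tnth.
Qed.

Section boundary.
Variable (eta : config E).

Definition tuple_weight M (t : M.-tuple E) : \bar R :=
  (\1_(tuples_in M) t)%:E * boltzmann beta (seq_energy Psi Phi eta t).

Lemma tuple_weight_ge0 M (t : M.-tuple E) : 0 <= tuple_weight t.
Proof. by rewrite mule_ge0 ?lee_fin//; exact: expeR_ge0. Qed.

Lemma measurable_tuple_weight M : measurable_fun setT (@tuple_weight M).
Proof.
apply: emeasurable_funM.
  by apply/measurable_EFinP; apply: measurable_indic; exact: measurable_tuples_in.
apply: (measurableT_comp (@measurable_expeR R)); apply: measurableT_comp => //.
by apply: measurable_funeM; exact: measurable_seq_energy.
Qed.

Variable k : E -> R.
Hypothesis eta_out : forall y, atoms eta y -> ~ window L y.
Hypothesis eta_k : forall x s, (- k x)%:E <=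
  point_energy Phi x (config_union (config_of_seq s) eta).

Let point_energy_eta x : -oo < point_energy Phi x eta.
Proof.
rewrite (_ : eta = config_union (config_of_seq [::]) eta).
  exact: lt_le_trans (ltNyr _) (eta_k x [::]).
by apply: config_eq; rewrite /= set_nil set0U.
Qed.

Let seq_energyNy s : -oo < seq_energy Psi Phi eta s.
Proof.
elim: s => [|x s IH]; first by rewrite /seq_energy /= big_nil adde0.
rewrite seq_energy_cons; apply: gtNy_adde IH; apply: gtNy_adde.
  exact: potential_gtNy.
apply: gtNy_adde (point_energy_eta x).
elim: s => [|y s IHs]; first by rewrite big_nil.
by rewrite big_cons; apply: gtNy_adde IHs; exact: potential_gtNy.
Qed.

(* The energy of a point given all the others and [eta] is at least [- k], as
   [eta] enlarged by finitely many points is again tempered. *)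
Lemma tuple_weight_remove M (i : 'I_M.+1) (t : M.+1.-tuple E) :
  tuple_weight t <= boltzmann beta (Psi (tnth t i)) *
    (expR (beta%:num * k (tnth t i)))%:E * tuple_weight (tuple_remove i t).
Proof.
rewrite {1}/tuple_weight indicE.
have [/set_mem[Dt Lt]|_] := boolP (t \in tuples_in M.+1); last first.
  rewrite mul0e; apply: mule_ge0; last exact: tuple_weight_ge0.
  by apply: mule_ge0; [exact: expeR_ge0|rewrite lee_fin expR_ge0].
have Dr : tuples_in M (tuple_remove i t).
  split => [j l jl|j]; rewrite ?tnth_mktuple; last exact: Lt.
  by apply: Dt; apply: contra jl => /eqP /lift_inj ->.
rewrite mul1e /tuple_weight indicE mem_set// mul1e.
have ut := distinct_sites_uniq Dt; have ur := distinct_sites_uniq Dr.1.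
have it : tnth t i \notin tuple_remove i t.
  apply/negP => /tnthP[j]; rewrite tnth_mktuple => /(tuple_uniqP _ ut) /eqP.
  by rewrite (negbTE (neq_lift _ _)).
have tsub : {subset tuple_remove i t <= t}.
  by move=> x /tnthP[j ->]; rewrite tnth_mktuple mem_tnth.
have tE : perm_eq t (tnth t i :: tuple_remove i t).
  apply: uniq_perm => //=; first by rewrite it.
  move=> x; rewrite in_cons; apply/idP/orP => [/tnthP[j ->]|[/eqP->|/tsub//]].
    case: (unliftP i j) => [l ->|->]; last by left.
    by right; rewrite -(tnth_mktuple (fun l => tnth t (lift i l)) l) mem_tnth.
  exact: mem_tnth.
(* The points of [eta] lie outside the window and the other entries inside, so the union is disjoint
   and [eta_k] bounds the whole interaction of the removed point. *)
rewrite (perm_seq_energy _ _ _ tE)// seq_energy_cons -point_energy_union//; last first.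
  by move=> _ /tnthP[j ->] /eta_out; apply; exact: Dr.2.
set pe := point_energy _ _ _.
have kpe : (- k (tnth t i))%:E <= pe by exact: eta_k.
have -> : (expR (beta%:num * k (tnth t i)))%:E =
    boltzmann beta (- k (tnth t i))%:E.
  by rewrite /boltzmann -EFinM -EFinN/= mulrN opprK.
have Psi_gt := potential_gtNy Psi (tnth t i).
have k_gt : -oo < (- k (tnth t i))%:E by exact: ltNyr.
rewrite -!boltzmannD//; last exact: gtNy_adde.
by apply: boltzmann_le; rewrite leeD2r// leeD2l.
Qed.

End boundary.
End weights.

(** * Gibbs point processes *)

Section window_bound.
Context (R : realType) (n : nat) (S : normedModType R).
Local Notation E := (marked_space n S).
Variables (Q : probability (marks S) R) (Psi : potential E R)
  (Phi : potential (E * E)%type R) (z beta : {posnum R}) (L : set (Rd R n)).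
Hypothesis Phi_sym : forall x y, Phi (x, y) = Phi (y, x).
Hypothesis mL : measurable L.
Local Notation lam := (@lambda_measure R n S Q).
Local Notation sites M := (@distinct_sites R n S M).

Lemma integral_poisson_tilde (phi : config E -> \bar R) :
  measurable_fun setT phi -> (forall g, 0 <= phi g) ->
  \int[poisson_tilde n Q z]_g phi g = \sum_(M <oo) (z%:num ^+ M / M`!%:R)%:E *
    \int[tensor lam M]_(t in sites M) phi (config_of_tuple t).
Proof.
move=> mphi phi0; rewrite ge0_integral_measure_series//.
apply: eq_eseriesr => M _; rewrite ge0_integral_mscale//; congr (_ * _).
have mc := @measurable_config_of_tuple R n S M.
rewrite (ge0_integral_pushforward mc)// preimage_setT.
exact: (ge0_integral_mrestr _ _ (measurableT_comp mphi mc) (fun=> phi0 _)).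
Qed.

Lemma integral_poisson (phi : config E -> \bar R) :
  measurable_fun setT phi -> (forall g, 0 <= phi g) ->
  \int[poisson Q z L]_g phi g =
  (expR (- (z%:num * fine (lebesgue_Rd R n L))))%:E *
    \int[poisson_tilde n Q z]_g phi g.
Proof. by move=> mphi phi0; rewrite ge0_integral_mscale. Qed.

Lemma config_of_tupleE M (t : M.-tuple E) : distinct_sites t ->
  config_of_tuple t = config_of_seq t.
Proof. by move=> Dt; rewrite /config_of_tuple asboolT. Qed.

Lemma restr_id (W : set E) (g : config E) : g `<=` W -> config_restr g W = g.
Proof. by move=> gW; apply: config_eq; rewrite /= setIidl. Qed.

Section boundary.
Variable xi : config E.
Local Notation eta := (config_restr xi (window (~` L))).

Lemma gibbs_weight_of_seq M (t : M.-tuple E) : tuples_in L t ->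
  gibbs_weight Psi Phi beta L (config_of_seq t) xi =
  boltzmann beta (seq_energy Psi Phi eta t).
Proof.
move=> [Dt Lt]; rewrite /gibbs_weight restr_id; last exact/config_of_seq_in.
by rewrite energy_config_of_seq//; exact: distinct_sites_uniq.
Qed.

Lemma gibbs_weight_ge0 g : 0 <= gibbs_weight Psi Phi beta L g xi.
Proof. exact: expeR_ge0. Qed.

(** The series of the partition function over tuples, without the factor [exp(-z |L|)]. *)
Let weight_mass := \sum_(M <oo) (z%:num ^+ M / M`!%:R)%:E *
    \int[tensor lam M]_t tuple_weight Psi Phi beta L eta t.

Let weight_mass_ge0 : 0 <= weight_mass.
Proof.
apply: nneseries_ge0 => M _ _; rewrite mule_ge0 ?lee_fin ?activity_weight_ge0//.
by apply: integral_ge0 => t _; exact: tuple_weight_ge0.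
Qed.

(** Measurability of the weight is available on [G], the configurations enumerated by tuples with
    distinct sites. Cutting the weight to zero outside [G] can only lower the partition function,
    and changes nothing in the sum over tuples, which only meets members of [G]. *)
Lemma partition_function_ge :
  (expR (- (z%:num * fine (lebesgue_Rd R n L))))%:E * weight_mass <=
  partition_function Q Psi Phi z beta L xi.
Proof.
pose C : set (config E) := configs_in (window L).
pose w g := gibbs_weight Psi Phi beta L g xi.
have wC0 g : 0 <= (w \_ C) g by apply: erestrict_ge0 => x _; exact: expeR_ge0.
(* Pulled back to tuples with distinct sites, the weight cut to the window is [tuple_weight]; this
   gives the measurability that [measurable_symmetric] asks for. *)
have wE M (t : M.-tuple E) : (\1_(sites M) t)%:E * (w \_ C) (config_of_seq t) =
    tuple_weight Psi Phi beta L eta t.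
  rewrite /tuple_weight !indicE; have [Dt|Dt] := boolP (t \in sites M); last first.
    rewrite mul0e memNset ?mul0e// => -[/mem_set Dt' _].
    by rewrite Dt' in Dt.
  rewrite patchE mul1e; case: ifPn => [/set_mem/config_of_seq_in tL|tL].
    have tA : tuples_in L t by split => //; exact: set_mem.
    by rewrite [t \in _]mem_set// mul1e /w gibbs_weight_of_seq.
  rewrite memNset ?mul0e// => -[_ Lt]; move/negP: tL; apply.
  exact/mem_set/config_of_seq_in.
have mD M : measurable (sites M) by exact: measurable_distinct_sites.
have uD M (t : M.-tuple E) : sites M t -> uniq t by exact: distinct_sites_uniq.
pose G := \bigcup_M enumerated R (fun M => sites M) M.
have mG : measurable G.
  by apply: bigcup_measurable => M _; exact: (measurable_enumerated R mD M).
have mw M : measurable_fun setT (fun t : M.-tuple E =>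
    (\1_(sites M) t)%:E * (w \_ C) (config_of_seq t)).
  rewrite (_ : (fun t => _) = @tuple_weight _ _ _ Psi Phi beta L eta M).
    exact: measurable_tuple_weight.
  by apply/funext => t; exact: wE.
have mphi : measurable_fun setT ((w \_ C) \_ G).
  have mwG : measurable_fun G (w \_ C) := measurable_symmetric mD uD wC0 mw.
  exact: (measurable_restrictT _ mG).1 mwG.
have phi0 g : 0 <= ((w \_ C) \_ G) g by apply: erestrict_ge0 => x _; exact: wC0.
apply: (@le_trans _ _ (\int[poisson Q z L]_g ((w \_ C) \_ G) g)); last first.
  rewrite [leRHS]integral_mkcond; apply: le_lower_integral => // g.
  by rewrite patchE; case: ifP.
rewrite integral_poisson// integral_poisson_tilde//.
apply: lee_wpmul2l; first by rewrite lee_fin expR_ge0.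
apply: lee_nneseries => [M _ _|M _].
  rewrite mule_ge0 ?lee_fin ?activity_weight_ge0//.
  by apply: integral_ge0 => t _; exact: tuple_weight_ge0.
apply: lee_wpmul2l; first by rewrite lee_fin activity_weight_ge0.
rewrite [leRHS]integral_mkcond; apply: le_lower_integral => [t|t].
  exact: tuple_weight_ge0.
rewrite -wE [leRHS]patchE indicE.
have [/set_mem Dt|_] := boolP (t \in sites M); last by rewrite mul0e.
rewrite mul1e config_of_tupleE// [leRHS]patchE mem_set//.
by exists M => //; exact: (config_of_seq_enumerated R mD uD Dt).
Qed.

Variable k : E -> R.
Hypotheses (mk : measurable_fun setT k).
Hypothesis eta_k : forall x s, (- k x)%:E <=
  point_energy Phi x (config_union (config_of_seq s) eta).

(** Here [F] stands for a simple function below the factorial measure. A simple [h] below the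
    integrand is expanded over tuples, where [F] is at most a selection sum, so that the Mecke bound
    applies. The factor [c] is common to both sides. *)
Lemma numerator_le N (A : set (N.-tuple E)) (F : config E -> R) :
  measurable A -> (forall u, A u -> forall i, window L (tnth u i)) ->
  (forall g, 0 <= F g)%R ->
  (forall g : config E, (F g)%:E <= factorial_measure R g A) ->
  \int[poisson Q z L]_(g in configs_in (window L))
    ((F (config_union (config_restr g (window L)) eta))%:E *
      gibbs_weight Psi Phi beta L g xi) <=
  (\int[tensor (activity_sigma Q beta Psi z) N]_u
    (\1_A u * \prod_(i < N) expR (beta%:num * k (tnth u i)))%:E) *
  partition_function Q Psi Phi z beta L xi.
Proof.
move=> mA AL F0 FA.
set c := expR (- (z%:num * fine (lebesgue_Rd R n L))).
set K := \int[tensor _ N]_u _.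
have K0 : 0 <= K.
  apply: integral_ge0 => u _; rewrite lee_fin mulr_ge0//.
  by apply: prodr_ge0 => i _; exact: expR_ge0.
apply: (@le_trans _ _ (K * (c%:E * weight_mass))); last first.
  by apply: lee_wpmul2l => //; exact: partition_function_ge.
have eta_out y : atoms eta y -> ~ window L y by move=> [_].
have mecke : \sum_(M <oo) (z%:num ^+ M / M`!%:R)%:E * \int[tensor lam M]_t
    ((selection_sum (\1_A : _ -> R) t)%:E * tuple_weight Psi Phi beta L eta t) <=
    K * weight_mass.
  have e0 x : 0 <= boltzmann beta (Psi x) by exact: expeR_ge0.
  have dens h : measurable_fun setT h -> (forall x, 0 <= h x) ->
      \int[activity_sigma Q beta Psi z]_x h x =
      z%:num%:E * \int[lam]_x (boltzmann beta (Psi x) * h x).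
    move=> mh h0; rewrite ge0_integral_mscale//; congr (_ * _).
    exact: ge0_integral_mdensity.
  have mc : measurable_fun setT (fun x => expR (beta%:num * k x)).
    by apply: measurableT_comp => //; exact: measurable_funM.
  have c0 x : (0 <= expR (beta%:num * k x))%R by exact: expR_ge0.
  have mw M : measurable_fun setT (@tuple_weight _ _ _ Psi Phi beta L eta M).
    exact: measurable_tuple_weight.
  have w0 M (t : M.-tuple E) := tuple_weight_ge0 Psi Phi beta L eta t.
  have wr := tuple_weight_remove Psi beta Phi_sym eta_out eta_k.
  have mA1 : measurable_fun setT (\1_A : _ -> R) by exact: measurable_indic.
  exact: (selection_sum_integral_le (measurable_boltzmann_potential beta Psi)
    e0 dens mc c0 mw w0 wr mA1).
rewrite integral_mkcond; apply: lower_integral_le => [g|h hF].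
  apply: erestrict_ge0 => x _; apply: mule_ge0; first by rewrite lee_fin.
  exact: gibbs_weight_ge0.
have mh : measurable_fun setT (fun g => (h g)%:E) by exact/measurable_EFinP.
rewrite integral_poisson//; last by move=> g; rewrite lee_fin.
rewrite integral_poisson_tilde//; last by move=> g; rewrite lee_fin.
rewrite muleCA; apply: lee_wpmul2l; first by rewrite lee_fin expR_ge0.
apply: le_trans mecke; apply: lee_nneseries => [M _ _|M _].
  rewrite mule_ge0 ?lee_fin ?activity_weight_ge0//.
  by apply: integral_ge0 => t _; rewrite lee_fin.
apply: lee_wpmul2l; first by rewrite lee_fin activity_weight_ge0.
have sw0 t : 0 <= (selection_sum (\1_A : _ -> R) t)%:E *
    tuple_weight Psi Phi beta L eta t :> \bar R.
  by apply: mule_ge0 (tuple_weight_ge0 _ _ _ _ _ _); rewrite lee_fin selection_sum_ge0.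
rewrite integral_mkcond; apply: le_lower_integral => [t|t].
  by apply: erestrict_ge0 => u _; rewrite lee_fin.
rewrite patchE; case: ifPn => [/set_mem Dt|_]; last exact: sw0.
apply: le_trans (hF _) _; rewrite config_of_tupleE// patchE.
case: ifPn => [/set_mem tL|_]; last exact: sw0.
have tA : tuples_in L t by split => //; exact/config_of_seq_in.
rewrite gibbs_weight_of_seq// /tuple_weight indicE [t \in _]mem_set// mul1e.
apply: lee_wpmul2r; first exact: expeR_ge0.
apply: le_trans (FA _) _.
apply: (@factorial_measure_le_selection_sum _ _ _ _ (window L)) => //.
  exact: distinct_sites_uniq.
(* The points of [eta] are outside the window, so every point of the union inside it is an entry of
   [t]. *)
by move=> y [[[]//|[_ yL]] /yL].
Qed.

End boundary.
End window_bound.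

(** * Measurability of norms and stability of temperedness *)

Lemma measurable_mark_norm (R : realType) (S : normedModType R) :
  measurable_fun setT (@mark_norm R S).
Proof.
apply: (measurability _ (RGenOInfty.measurableE R)) => // _ [_ [x ->] <-].
rewrite setTI; apply: sub_sigma_algebra.
rewrite (_ : _ @^-1` _ = (fun m : S => `|m|%R) @^-1` [set y | (x < y)%R]).
  apply: open_comp; last exact: open_gt.
  by move=> m _; exact: norm_continuous.
by apply/seteqP; split => m /=; rewrite in_itv/= andbT.
Qed.

Lemma measurable_euclidean_ball (R : realType) n (r : R) :
  measurable [set x : Rd R n | (euclidean_norm x <= r)%R].
Proof.
have [r0|r0] := ltP r 0%R.
  rewrite (_ : mkset _ = set0) //; apply/seteqP; split => // x /= xr.
  by have := le_lt_trans xr r0; rewrite ltNge sqrtr_ge0.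
pose f (x : Rd R n) : R := (\sum_(i < n) (tnth x i : R) ^+ 2)%R.
have mf : measurable_fun setT f.
  apply: measurable_sum => i; apply: measurable_funX.
  exact: (measurable_tnth (T := measurableTypeR R)).
rewrite (_ : mkset _ = setT `&` [set x | (f x)%:E <= (r ^+ 2)%:E]).
  by apply: measurable_lee => //; exact/measurable_EFinP.
rewrite setTI; apply/seteqP; split => x /=; rewrite lee_fin /euclidean_norm -/(f x).
  move=> xr; rewrite -(@sqr_sqrtr _ (f x)) ?lerXn2r ?nnegrE ?sqrtr_ge0//.
  by apply: sumr_ge0 => i _; exact: sqr_ge0.
by move=> xr; rewrite -(ger0_norm r0) -sqrtr_sqr ler_wsqrtr.
Qed.

(** The inequality covers the degenerate cases: the product is [0] when [Z] is [0] or [+oo]. *)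
Lemma inve_mul_le1 (R : realType) (Z : \bar R) : 0 <= Z -> Z^-1 * Z <= 1.
Proof.
case: Z => [r| |]//; last by rewrite invey mul0e.
rewrite lee_fin inver; case: eqP => [->|/eqP r0 _]; first by rewrite mule0.
by rewrite -EFinM mulVf.
Qed.

(** The points of [s] add at most their total weight at every radius, and a larger [t] absorbs it
    because [l ^ n] is at least [1]. *)
Lemma tempered_union (R : realType) n (S : normedModType R) (delta : R)
    (xi : config (marked_space n S)) W s :
  tempered delta xi ->
  tempered delta (config_union (config_of_seq s) (config_restr xi W)).
Proof.
move=> [t t0 xit].
pose a (x : marked_space n S) := (1 + mark_norm x.2 `^ (n%:R + 2 * delta))%R.
have a0 x : (0 <= a x)%R by rewrite addr_ge0 ?powR_ge0.
pose A := (\sum_(x <- undup s) a x)%R.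
have A0 : (0 <= A)%R by exact: sumr_ge0.
pose K := (Num.truncn A).+1.
have AK : (A <= K%:R)%R by apply/ltW; exact: truncnS_gt.
exists (t + K)%N; first by rewrite /= addn_gt0 t0.
move=> l l0; set B := [set x | _].
pose X := [set x | atoms xi x /\ (euclidean_norm x.1 <= l%:R)%R].
have a0' x : 0 <= (a x)%:E by rewrite lee_fin.
(* Atoms of [xi] in the ball are controlled by its temperedness; all other points come from [s],
   each counted once through [undup]. *)
rewrite (esumID X B (fun x => (a x)%:E) (fun x _ => a0' x)).
apply: (@le_trans _ _ ((t%:R * l%:R ^+ n)%:E + A%:E)).
  apply: leeD.
    by apply: le_trans (xit l l0); apply: esum_subset => x [].
  have BX : B `&` ~` X `<=` [set` undup s].
    move=> x [[/= [xs|[xix _]] xl] xX]; first by rewrite mem_undup.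
    by case: xX.
  apply: le_trans (esum_subset _ BX) _.
  by rewrite esum_seq ?undup_uniq// sumEFin.
rewrite -EFinD lee_fin natrD mulrDl lerD2l (le_trans AK)// ler_peMr//.
by apply: exprn_ege1; rewrite ler1n.
Qed.

(** * From integral inequalities to almost everywhere inequalities *)

Section comparison.
Context d (T : measurableType d) (R : realType).
Variable mu : {sigma_finite_measure set T -> \bar R}.

(** The exceptional set is covered by countably many pieces [D] of finite measure, each inside some
    [U k], on which [C <= l] and [rho >= C + 1/(m+1)]. There the integral of [C] is finite and
    cancels, which leaves [mu D / (m+1) <= 0]. *)
Lemma ae_le_of_integral_le (rho : T -> \bar R) (C : T -> R) (U : (set T)^nat) :
  measurable_fun setT rho -> (forall x, 0 <= rho x) ->
  measurable_fun setT C -> (forall x, 0 <= C x)%R ->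
  (forall i, measurable (U i)) -> (forall x, exists i, U i x) ->
  (forall i A, measurable A -> A `<=` U i ->
    \int[mu]_(x in A) rho x <= \int[mu]_(x in A) (C x)%:E) ->
  mu [set x | (C x)%:E < rho x] = 0.
Proof.
move=> mrho rho0 mC C0 mU UT le_int.
have mCE : measurable_fun setT (fun x => (C x)%:E) by exact/measurable_EFinP.
have [G GT mG] := sigma_finiteT mu.
pose V m : set T := [set x | (C x)%:E <= m%:R%:E].
pose W m : set T := [set x | (C x + m.+1%:R^-1)%:E <= rho x].
have mCm m : measurable_fun setT (fun x => (C x + m.+1%:R^-1)%:E).
  by apply/measurable_EFinP; exact: measurable_funD.
pose B i k l m := (G i `&` U k) `&` (V l `&` W m).
have mB i k l m : measurable (B i k l m).
  have [mGi _] := mG i.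
  apply: measurableI; first exact: measurableI.
  apply: measurableI; rewrite -[X in measurable X]setTI; exact: measurable_lee.
have B0 i k l m : mu (B i k l m) = 0.
  have [mGi Gi] := mG i.
  set D := B i k l m; have mD : measurable D by exact: mB.
  have muD : mu D < +oo.
    by apply: le_lt_trans Gi; apply: le_measure; rewrite ?inE// => x [[]].
  have m0 : (0 < m.+1%:R^-1 :> R)%R by rewrite invr_gt0.
  have CD : \int[mu]_(x in D) (C x)%:E \is a fin_num.
    rewrite ge0_fin_numE; last by apply: integral_ge0 => x _; rewrite lee_fin.
    apply: (@le_lt_trans _ _ (\int[mu]_(x in D) (cst l%:R%:E x))).
      apply: ge0_le_integral => //.
      - by move=> x _; rewrite lee_fin.
      - exact: measurable_funTS.
      - by move=> x [_ []].
    by rewrite integral_cst// lte_mul_pinfty// lee_fin.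
  have : \int[mu]_(x in D) (C x + m.+1%:R^-1)%:E <= \int[mu]_(x in D) (C x)%:E.
    apply: (@le_trans _ _ (\int[mu]_(x in D) rho x)).
      apply: ge0_le_integral => //.
      - by move=> x _; rewrite lee_fin addr_ge0// ltW.
      - exact: measurable_funTS.
      - exact: measurable_funTS.
      - by move=> x [_ []].
    by apply: (le_int k) => // x [[]].
  under eq_integral do rewrite EFinD.
  have C0D x : D x -> 0 <= (C x)%:E by rewrite lee_fin.
  have mCD : measurable_fun D (fun x => (C x)%:E) by exact: measurable_funTS.
  have m0D x : D x -> 0 <= (m.+1%:R^-1)%:E :> \bar R by rewrite lee_fin ltW.
  rewrite ge0_integralD//.
  rewrite integral_cst// -[leRHS]adde0 leeD2lE// => le0.
  apply/eqP; rewrite eq_le; apply/andP; split; last exact: measure_ge0.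
  by move: le0; rewrite pmule_rle0 ?lte_fin.
have : mu.-negligible (\bigcup_i \bigcup_k \bigcup_l \bigcup_m B i k l m).
  do 4 (apply: negligible_bigcup => ?).
  by apply/negligibleP; [exact: mB|exact: B0].
move=> neg; apply: measure_negligible.
  by rewrite -[X in measurable X]setTI; exact: measurable_lte.
apply: negligibleS neg => x /= Crho.
have [i _ Gix] : (\bigcup_i G i) x by rewrite -GT.
have [k Ukx] := UT x.
exists i => //; exists k => //; exists (Num.truncn (C x)).+1 => //.
have [m Wm] : exists m, W m x.
  have [rhooo|rhofin] := eqVneq (rho x) +oo.
    by exists 0%N; rewrite /W /= rhooo leey.
  have rfin : rho x \is a fin_num by rewrite ge0_fin_numE// ltey.
  move: Crho; rewrite /W/= -(fineK rfin) lte_fin => Crho.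
  (* With this [m], [m.+1] exceeds the inverse of the gap between [C x] and [rho x]. *)
  exists (Num.truncn (fine (rho x) - C x)^-1).
  rewrite lee_fin -lerBrDl invf_ple ?posrE ?subr_gt0//.
  by apply/ltW; exact: truncnS_gt.
exists m => //; split; [by split|split; last exact: Wm].
by rewrite /V/= lee_fin; apply/ltW; exact: truncnS_gt.
Qed.

(** This serves to transfer null sets from powers of [z sigma], where the densities are compared, to
    powers of [sigma]. *)
Lemma tensor_scale (nu : {sigma_finite_measure set T -> \bar R}) (r : R) :
  (forall h, measurable_fun setT h -> (forall x, 0 <= h x) ->
    \int[nu]_x h x = r%:E * \int[mu]_x h x) -> (0 <= r)%R ->
  forall N A, measurable A -> tensor nu N A = (r ^+ N)%:E * tensor mu N A.
Proof.
move=> nuE r0; elim=> [|N IH] A mA; first by rewrite expr0 mul1e.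
pose P := @tuple_cons _ T N @^-1` A.
have mP : measurable P.
  by rewrite -[P]setTI; exact: measurable_tuple_cons.
have sec (la : {sigma_finite_measure set T -> \bar R}) : tensor la N.+1 A =
    \int[la]_x tensor la N (xsection P x) by [].
rewrite !sec exprS EFinM -[RHS]muleA.
have mint : measurable_fun setT (fun x => tensor mu N (xsection P x)).
  exact: measurable_fun_xsection.
rewrite -ge0_integralZl_EFin ?exprn_ge0// -nuE.
- by apply: eq_integral => x _; rewrite IH//; exact: measurable_xsection.
- exact: measurable_funeM.
- by move=> x; rewrite mule_ge0// lee_fin exprn_ge0.
Qed.

End comparison.

(** * The Ruelle bound *)

Section ruelle.
Context (R : realType) (d : nat) (S : normedModType R).
Local Notation E := (marked_space d S).
Variables (Q : probability (marks S) R) (Psi : potential E R)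
  (Phi : potential (E * E)%type R) (delta : R) (z beta : {posnum R}).
Hypothesis Phi_sym : forall x y, Phi (x, y) = Phi (y, x).
Variable k : E -> R.
Hypotheses (mk : measurable_fun setT k)
  (hcond : forall x xi, tempered delta xi -> (- k x)%:E <= point_energy Phi x xi).
Variable P : probability (config E) R.
Hypothesis hP : tempered_gibbs Q Psi Phi delta z beta P.

(** The DLR equation is tested on bounded measurable functions, while the factorial measure of [A]
    may be unbounded and is not known to be measurable in the configuration. Simple functions below
    it are admissible, and its integral is the supremum of theirs. *)
Lemma factorial_moment_le (L : set (Rd R d)) N (A : set (N.-tuple E)) :
  bounded_borel L -> measurable A ->
  (forall u, A u -> forall i, window L (tnth u i)) ->
  factorial_moment P A <= \int[tensor (activity_sigma Q beta Psi z) N]_u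
    (\1_A u * \prod_(i < N) expR (beta%:num * k (tnth u i)))%:E.
Proof.
move=> bL mA AL; have [gibbsP temperedP] := hP.
set K := \int[_]_u _.
have K0 : 0 <= K.
  apply: integral_ge0 => u _; rewrite lee_fin mulr_ge0//.
  by apply: prodr_ge0 => i _; exact: expR_ge0.
apply: lower_integral_le => [g|h hA]; first exact: factorial_measure_ge0.
have [M [_ hM]] := simple_bounded h.
have h_bounded : exists C, forall g, (h g <= C)%R.
  exists (M + 1)%R => g; apply: le_trans (ler_norm _) _.
  by apply: hM => //; rewrite ltrDl.
have [_ dlr] := gibbsP L bL.
rewrite (dlr h _ _ h_bounded)//.
have Z0 xi : 0 <= partition_function Q Psi Phi z beta L xi.
  by apply: integral_ge0 => g _; exact: gibbs_weight_ge0.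
apply: ae_le_lower_integral => //.
  move=> xi; rewrite mule_ge0 ?inve_ge0//; apply: integral_ge0 => g _.
  by rewrite mule_ge0 ?lee_fin//; exact: gibbs_weight_ge0.
(* Almost every boundary condition is tempered, and remains so when cut outside [L] and enlarged by
   finitely many points, so [hcond] applies. *)
apply: filterS temperedP => xi txi.
have eta_k x s : (- k x)%:E <= point_energy Phi x
    (config_union (config_of_seq s) (config_restr xi (window (~` L)))).
  by apply: hcond; exact: tempered_union.
have num_le := @numerator_le R d S Q Psi Phi z beta L Phi_sym bL.1 xi k mk eta_k
  N A h mA AL (fun g => fun_ge0 g) hA.
apply: (@le_trans _ _ ((partition_function Q Psi Phi z beta L xi)^-1 *
    (K * partition_function Q Psi Phi z beta L xi))).
  by apply: lee_wpmul2l; [rewrite inve_ge0|exact: num_le].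
rewrite muleCA -[leRHS]mule1; apply: lee_wpmul2l => //.
exact: inve_mul_le1.
Qed.

(** Balls of integer radius are bounded windows, so the integrals compare on sets of tuples over a
    ball, and every tuple lies over some ball. *)
Lemma correlation_function_le N (rho : N.-tuple E -> \bar R) :
  is_correlation_function (activity_sigma Q beta Psi z) P rho ->
  {ae tensor (sigma_measure Q beta Psi) N, forall u,
    rho u <= (\prod_(i < N) expR (beta%:num * k (tnth u i)))%:E}.
Proof.
move=> [mrho rho0 rhoE].
pose C (u : N.-tuple E) : R := (\prod_(i < N) expR (beta%:num * k (tnth u i)))%R.
have mC : measurable_fun setT C.
  apply: measurable_prod => i _; apply: measurableT_comp => //.
  apply: measurable_funM => //; exact: (measurableT_comp mk (measurable_tnth i)).
have C0 u : (0 <= C u)%R by apply: prodr_ge0 => i _; exact: expR_ge0.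
pose L l : set (Rd R d) := [set x | (euclidean_norm x <= l%:R)%R].
have mL l : measurable (L l) by exact: measurable_euclidean_ball.
have bL l : bounded_borel (L l) by split => //; exists l%:R.
pose U l : set (N.-tuple E) := [set u | forall i, window (L l) (tnth u i)].
have mU l : measurable (U l).
  rewrite (_ : U l = \bigcap_(i in [set: 'I_N]) (@tnth _ E ^~ i @^-1` window (L l))).
    apply: fin_bigcap_measurable => // i _.
    rewrite -[X in measurable X]setTI; apply: measurable_tnth => //.
    exact: measurable_window.
  by apply/seteqP; split => t h i; [move=> _; exact: h|exact: (h i I)].
have UT u : exists l, U l u.
  pose f (i : 'I_N) := (Num.truncn (euclidean_norm (tnth u i).1)).+1.
  exists (\max_(i < N) f i) => i; apply: (@le_trans _ _ (f i)%:R).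
    by apply/ltW; exact: truncnS_gt.
  by rewrite ler_nat; exact: (@leq_bigmax _ f i).
have null : tensor (activity_sigma Q beta Psi z) N [set u | (C u)%:E < rho u] = 0.
  apply: (ae_le_of_integral_le mrho rho0 mC C0 mU UT) => l A mA AU.
  rewrite -rhoE//; apply: le_trans (factorial_moment_le (bL l) mA AU) _.
  rewrite [leRHS]integral_mkcond le_eqVlt; apply/orP; left; apply/eqP.
  apply: eq_integral => u _; rewrite patchE indicE.
  by case: ifP => _; rewrite ?mul1r ?mul0r.
have mlt : measurable [set u | (C u)%:E < rho u].
  rewrite -[X in measurable X]setTI; apply: measurable_lte => //.
  exact/measurable_EFinP.
exists [set u | (C u)%:E < rho u]; split => //; last first.
  by move=> u /=; rewrite leNgt => /negP; rewrite negbK.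
(* As [z ^ N] is nonzero, the two powers have the same measurable null sets. *)
move: null; rewrite (tensor_scale (mu := sigma_measure Q beta Psi) (r := z%:num))//.
  move=> /eqP; rewrite mule_eq0 => /orP[|/eqP//].
  by rewrite eqe expf_eq0 gt_eqF ?andbF.
by move=> h mh h0; rewrite ge0_integral_mscale.
Qed.

End ruelle.

Theorem proposition2p6 (R : realType) (d : nat) (hd : (0 < d)%N)
  (delta : R) (hdelta : (0 < delta)%R) (S : normedModType R)
  (Q : probability (marks S) R)
  (hQ : \int[Q]_m (expR (mark_norm m `^ (d%:R + 2 * delta)))%:E < +oo)
  (z beta : {posnum R})
  (Psi : potential (marked_space d S) R)
  (Phi : potential (marked_space d S * marked_space d S)%type R)
  (Phi_sym : forall x y : marked_space d S, Phi (x, y) = Phi (y, x))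
  (A_Psi : R) (hA : (0 < A_Psi)%R)
  (hPsi : forall m : marks S,
    (- (A_Psi * mark_norm m `^ (d%:R + delta)))%:E <=
    ereal_inf [set Psi (x, m) | x in [set: Rd R d]])
  (B_Phi : R) (hB : (0 <= B_Phi)%R)
  (hstable : forall g : config (marked_space d S), finite_set g ->
    (- B_Phi)%:E * \sum_(x \in g) (1 + mark_norm x.2 `^ (d%:R + delta))%:E <=
    pair_energy Phi g)
  (a0 : R) (ha0 : (0 <= a0)%R)
  (hrange : forall x y : marked_space d S,
    (a0 + mark_norm x.2 + mark_norm y.2 < euclidean_dist x.1 y.1)%R -> Phi (x, y) = 0)
  (Bbar_Phi : R) (hBbar : (0 <= Bbar_Phi)%R)
  (hcond : forall (x : marked_space d S) (xi : config (marked_space d S)),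
    tempered delta xi ->
    (- (Bbar_Phi * (1 + mark_norm x.2 `^ (d%:R + delta))))%:E <=
    point_energy Phi x xi)
  (P : probability (config (marked_space d S)) R)
  (hP : tempered_gibbs Q Psi Phi delta z beta P)
  (N : nat) (hN : (0 < N)%N)
  (rho : N.-tuple (marked_space d S) -> \bar R)
  (hrho : is_correlation_function (activity_sigma Q beta Psi z) P rho) :
  {ae tensor (sigma_measure Q beta Psi) N, forall x,
    rho x <= (\prod_(i < N)
      expR (beta%:num * (B_Phi + Bbar_Phi) *
        (1 + mark_norm (tnth x i).2 `^ (d%:R + delta))))%:E}.
Proof.
(* By [hcond], [- k x] bounds below the energy of [x] in a tempered configuration. *)
pose k (x : marked_space d S) : R :=
  (Bbar_Phi * (1 + mark_norm x.2 `^ (d%:R + delta)))%R.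
have mk : measurable_fun setT k.
  apply: measurable_funM => //; apply: measurable_funD => //.
  apply: (measurableT_comp (measurable_powR _)).
  exact: (measurableT_comp (@measurable_mark_norm R S) measurable_snd).
have [A [mA A0 subA]] := correlation_function_le Phi_sym mk hcond hP hrho.
exists A; split => //; apply: subset_trans subA => u /=; apply: contra_not => le.
(* The exponents obtained are [beta * k]; replacing [Bbar_Phi] by [B_Phi + Bbar_Phi] can only
   increase them, as [B_Phi] is nonnegative. *)
apply: le_trans le _; rewrite lee_fin; apply: ler_prod => i _.
rewrite expR_ge0/= ler_expR -mulrA ler_pM2l// ler_wpM2r//.
  by rewrite addr_ge0// powR_ge0.
by rewrite lerDr.
Qed.
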